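(* Let $P\subset \mathbb{R}^n$ be a smooth lattice polytope of dimension $n$. Then the following statements are equivalent: (1) $P$ is $\mathbb{Q}$-normal and $\operatorname{codeg}(P)\geq \frac{n+3}{2}$; (2) $P=\operatorname{Cayley}_{\Sigma}(P_0,\ldots,P_k)$ is a smooth strict Cayley polytope, where $k+1=\operatorname{codeg}(P)$ and $k>\frac{n}{2}$; (3) the complex polarized toric variety $(X,L)$ corresponding to $P$ is defective, with defect $\delta = 2\operatorname{codeg}(P) - 2 - n$.
   Context: A lattice polytope is a convex polytope with vertices in $\mathbb{Z}^n$. Write an $n$-dimensional lattice polytope as $P=\bigcap_{i=1}^r H^+_{\rho_i,-a_i}$, where $H^+_{\rho_i,-a_i}=\{x\in\mathbb{R}^n : \langle \rho_i,x\rangle\ge -a_i\}$, $\rho_i$ are the primitive inner facet normals and $a_i\in\mathbb{Z}$. $P$ is smooth if every vertex is the intersection of exactly $n$ of the facet hyperplanes $H_{\rho_i,-a_i}=\{\langle\rho_i,x\rangle=-a_i\}$ and the corresponding $n$ normals form a basis of $\mathbb{Z}^n$. For an integer $s\ge1$ put $P^{(s)}=\bigcap_{i=1}^r H^+_{\rho_i,-a_i+s}$. If $m$ is a vertex with $\{m\}=\bigcap_{i=1}^n H_{\rho_i,-a_i}$ (after reordering), let $m(s)$ be the point with $\{m(s)\}=\bigcap_{i=1}^n H_{\rho_i,-a_i+s}$; $P$ is $s$-spanned if $m(s)\in P^{(s)}$ for every vertex $m$. Codegree: $\operatorname{codeg}(P)=\min\{k\in\mathbb{N} : (kP)^{(1)}\cap\mathbb{Z}^n\neq\emptyset\}$.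 $\mathbb{Q}$-codegree: $\operatorname{codeg}_{\mathbb{Q}}(P)=\inf\{a/b : a,b\in\mathbb{Z}_{>0},\ (aP)^{(b)}\ne\emptyset\}$. Nef value of a smooth $P$: $\tau(P)=\inf\{a/b : aP \text{ is } b\text{-spanned}\}$. $P$ is $\mathbb{Q}$-normal if $\operatorname{codeg}_{\mathbb{Q}}(P)=\tau(P)$. Strict Cayley polytope: let $P_0,\ldots,P_k\subset\mathbb{R}^m$ be lattice polytopes all having the same (inner) normal fan $\Sigma$, let $e_1,\ldots,e_k$ be a basis of $\mathbb{Z}^k$ and $e_0=0$. Any polytope affinely equivalent to $\operatorname{Conv}\{(v,e_j): 0\le j\le k,\ v \text{ a vertex of } P_j\}\subset\mathbb{R}^{m+k}$ is denoted $\operatorname{Cayley}_\Sigma(P_0,\ldots,P_k)$ and called a strict Cayley polytope. The polarized toric variety $(X,L)$ corresponding to $P$: $X$ is the (nonsingular, projective) toric variety of the inner normal fan of $P$, and $L=\sum_i a_iD_i$, where $D_i$ is the torus-invariant divisor corresponding to $\rho_i$; $L$ is ample, and $X$ is embedded in $\mathbb{P}^N$ by the complete linear system $|L|$, whose sections have the lattice points of $P$ as a basis. A projective variety $X\subset\mathbb{P}^N$ is defective if its dual variety $X^*\subset(\mathbb{P}^N)^\vee$ is not a hypersurface; its defect is $\delta=N-1-\dim X^*$. *)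

(* Defs.v *)
From HB Require Import structures.
From mathcomp Require Import all_boot all_order all_algebra.
From mathcomp Require Import classical_sets reals Rstruct.
From mathcomp Require Import complex.
From mathcomp Require Import mpoly.

Set Implicit Arguments.
Unset Strict Implicit.
Unset Printing Implicit Defensive.

Import Order.TTheory GRing.Theory Num.Theory.
Local Open Scope ring_scope.
Local Open Scope classical_set_scope.

Notation Rl := Rdefinitions.R.
Definition Cx : numClosedFieldType := (Rdefinitions.R)[i].

Definition intRV (d : nat) (z : 'rV[int]_d) : 'rV[Rl]_d := map_mx intr z.

Definition dotZ (d : nat) (u : 'rV[int]_d) (x : 'rV[Rl]_d) : Rl :=
  \sum_(j < d) (u 0 j)%:~R * x 0 j.

Definition dotR (d : nat) (u x : 'rV[Rl]_d) : Rl := \sum_(j < d) u 0 j * x 0 j.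

Definition Hset (n r : nat) (rho : 'I_r -> 'rV[int]_n) (b : 'I_r -> int)
  : set 'rV[Rl]_n :=
  [set x | forall i, - ((b i)%:~R : Rl) <= dotZ (rho i) x].

Definition is_vertex (d : nat) (S : set 'rV[Rl]_d) (x : 'rV[Rl]_d) : Prop :=
  S x /\ forall y z, S y -> S z -> x = 2^-1 *: (y + z) -> y = z.

(* The data (rho, a) describe an n-dimensional lattice polytope
   P = \bigcap_i H^+_{rho_i,-a_i}, where the rho_i are primitive inner facet
   normals (each inequality defines a facet, i.e. the description is
   irredundant) and the vertices are lattice points. *)
Definition lattice_polytope_data (n r : nat) (rho : 'I_r -> 'rV[int]_n)
  (a : 'I_r -> int) : Prop :=
  [/\
      exists M : Rl, forall x, Hset rho a x -> forall j, `|x 0 j| <= M,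
      exists x : 'rV[Rl]_n, forall i, - ((a i)%:~R : Rl) < dotZ (rho i) x,
      forall i, exists x : 'rV[Rl]_n,
        dotZ (rho i) x = - (a i)%:~R /\
        forall i', i' != i -> - ((a i')%:~R : Rl) < dotZ (rho i') x,
      forall i (d : int), (forall j, (d %| rho i ord0 j)%Z) -> `|d| = 1
    &
      forall x, is_vertex (Hset rho a) x -> exists z : 'rV[int]_n, x = intRV z].

Definition smooth_polytope (n r : nat) (rho : 'I_r -> 'rV[int]_n)
  (a : 'I_r -> int) : Prop :=
  forall v, is_vertex (Hset rho a) v ->
    exists f : 'I_n -> 'I_r,
      [/\ injective f,
          (forall i, dotZ (rho i) v = - (a i)%:~R <-> exists l, f l = i)
        & `|\det (\matrix_(l < n, j < n) rho (f l) 0 j)| = 1].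

(* P^{(s)} for P = Hset rho a  is  Hset rho (a - s);  kP is Hset rho (k a). *)

(* P is s-spanned: for each vertex m, the point m(s) (determined by the
   facets through m, shifted by s) lies in P^{(s)}. *)
Definition s_spanned (n r : nat) (rho : 'I_r -> 'rV[int]_n)
  (a : 'I_r -> int) (s : int) : Prop :=
  forall m, is_vertex (Hset rho a) m ->
    forall y : 'rV[Rl]_n,
      (forall i, dotZ (rho i) m = - (a i)%:~R ->
                 dotZ (rho i) y = - (a i)%:~R + s%:~R) ->
      Hset rho (fun i => a i - s) y.

Definition codeg_spec (n r : nat) (rho : 'I_r -> 'rV[int]_n)
  (a : 'I_r -> int) (c : nat) : Prop :=
  (exists z : 'rV[int]_n, Hset rho (fun i => c%:Z * a i - 1) (intRV z)) /\
  forall k : nat, (k < c)%N ->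
    ~ exists z : 'rV[int]_n, Hset rho (fun i => k%:Z * a i - 1) (intRV z).

Definition codegQ (n r : nat) (rho : 'I_r -> 'rV[int]_n) (a : 'I_r -> int)
  : Rl :=
  inf [set q : Rl | exists p b : nat, [/\ (0 < p)%N, (0 < b)%N,
        q = p%:R / b%:R &
        exists x, Hset rho (fun i => p%:Z * a i - b%:Z) x]].

Definition nef_value (n r : nat) (rho : 'I_r -> 'rV[int]_n)
  (a : 'I_r -> int) : Rl :=
  inf [set q : Rl | exists p b : nat, [/\ (0 < p)%N, (0 < b)%N,
        q = p%:R / b%:R &
        s_spanned rho (fun i => p%:Z * a i) b%:Z]].

Definition Qnormal (n r : nat) (rho : 'I_r -> 'rV[int]_n) (a : 'I_r -> int)
  : Prop := codegQ rho a = nef_value rho a.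

Definition conv (d : nat) (S : seq 'rV[Rl]_d) : set 'rV[Rl]_d :=
  [set x | exists w : 'I_(size S) -> Rl,
     [/\ forall l, 0 <= w l, \sum_l w l = 1 & x = \sum_l w l *: S`_l]].

Definition face (d : nat) (Q : set 'rV[Rl]_d) (u : 'rV[Rl]_d) : set 'rV[Rl]_d :=
  [set x | Q x /\ forall y, Q y -> dotR u x <= dotR u y].

(* All Q_j have the same (inner) normal fan: the relatively open cones of the
   normal fan of Q are the classes of  u ~ u' <-> face Q u = face Q u'. *)
Definition same_normal_fan (K d : nat) (Q : 'I_K -> set 'rV[Rl]_d) : Prop :=
  forall j j' (u u' : 'rV[Rl]_d),
    face (Q j) u = face (Q j) u' <-> face (Q j') u = face (Q j') u'.

Definition cay_e (k : nat) (j : 'I_k.+1) : 'rV[Rl]_k :=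
  \row_(l < k) (if nat_of_ord j == l.+1 then 1 else 0).

Definition cayley_pts (m k : nat) (V : 'I_k.+1 -> seq 'rV[int]_m)
  : seq 'rV[Rl]_(m + k) :=
  flatten [seq [seq row_mx (intRV v) (cay_e j) | v <- V j] | j <- enum 'I_k.+1].

(* P = Cayley_Sigma(P_0, ..., P_k) (strict Cayley polytope), up to a
   lattice-preserving affine isomorphism Z^(m+k) -> Z^n. *)
Definition strict_cayley (n : nat) (P : set 'rV[Rl]_n) (k : nat) : Prop :=
  exists m : nat, exists V : 'I_k.+1 -> seq 'rV[int]_m,
    [/\ forall j, V j != [::],
        same_normal_fan (fun j => conv (map (@intRV m) (V j))) &
        exists (U : 'M[int]_(m + k, n)) (W : 'M[int]_(n, m + k)) (t : 'rV[int]_n),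
          [/\ U *m W = 1%:M, W *m U = 1%:M &
              P = [set x : 'rV[Rl]_n | exists y, conv (cayley_pts V) y /\
                              x = y *m map_mx intr U + intRV t]]].

Definition lmono (n : nat) (z : 'rV[int]_n) (t : 'I_n -> Cx) : Cx :=
  \prod_(j < n) (t j) ^ (z 0 j).

(* Affine cone over the set of hyperplanes sum_l xi_l X_l = 0 of P^N tangent to
   X_A = closure of {(t^z)_{z in A} : t in the torus (C^x)^n} at a point of the dense
   torus orbit: f_xi(t) = 0 and t_j d f_xi / d t_j (t) = 0 for all j. *)
Definition dual_cone (n : nat) (A : seq 'rV[int]_n) : set ('I_(size A) -> Cx) :=
  [set xi | exists t : 'I_n -> Cx,
     [/\ forall j, t j != 0,
         \sum_(l < size A) xi l * lmono A`_l t = 0 &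
         forall j, \sum_(l < size A) xi l * ((A`_l) 0 j)%:~R * lmono A`_l t = 0]].

Definition coord_indep (M : nat) (S : set ('I_M -> Cx)) (d : nat) : Prop :=
  exists f : 'I_d -> 'I_M, injective f /\
    forall p : mpoly.mpoly d Cx,
      (forall xi, S xi -> mpoly.meval (fun l => xi (f l)) p = 0) -> p = 0.

(* The Zariski closure of S has dimension d (= transcendence degree). *)
Definition zdim (M : nat) (S : set ('I_M -> Cx)) (d : nat) : Prop :=
  coord_indep S d /\ ~ coord_indep S d.+1.

(* The toric variety embedded by the lattice points A (P^N, N = size A - 1) is
   defective with defect delta: dim X^* = (dim of cone) - 1 and
   delta = N - 1 - dim X^*; defective means delta > 0 (X^* not a hypersurface). *)
Definition defective_with_defect (n : nat) (A : seq 'rV[int]_n) (delta : int)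
  : Prop :=
  exists dc : nat, zdim (@dual_cone n A) dc /\
    delta = (size A)%:Z - 1 - 1 - (dc%:Z - 1) /\ 0 < delta.

(* Main.v *)
(* For a smooth polytope each of the three conditions turns out to be equivalent
   to [2 c >= n + 3], where [c] is the codegree; (1), (2) and (3) give this bound
   at once, and the converse rests on the local structure at one vertex [v].

   Let [E_1, ..., E_n] be the primitive edge directions at [v], and call [i], [j]
   equivalent when [v + E_i + E_j] is not in [P]. Smoothness of the end point
   of the edge along [E_j] makes this a partial equivalence relation, whose
   classes are the faces at [v] that are unimodular simplices. If no class has
   more than [n / 2] elements, some permutation [s] never maps an index to an
   equivalent one, so [2 (E_1 + ... + E_n)], a sum of the [E_i + E_(s i)], lies in
   [n (P - v)] and the codegree is at most [n / 2 + 1]. Otherwise let [B] be the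
   large class and [h] the facet opposite to [v] in its simplex. Any nonzero
   coordinate of the normal of [h] outside [B] again yields a lattice point of
   [(n / 2) (P - v)] with all coordinates positive, so this normal is minus the
   sum of the normals dual to [B]. Hence [P] maps onto a unimodular simplex of
   dimension [#|B| = c - 1], which gives the Cayley structure and bounds
   the [Q]-codegree below by [c]; as [c v + E_1 + ... + E_n] lies in the adjoint
   polytope of [c P] for every [v], the nef value is at most [c].

   For the defect, the equations of the tangency cone split along the fibration:
   for a Laurent polynomial [\sum_j s_j f_j (t)], linear in the simplex variables,
   the equations [f_j (t) = 0] alone bound the dimension, by a polynomial
   parametrization, and it is attained because there are at least as many
   variables [s_j] as remaining equations. *)

Require Import Defs.
From HB Require Import structures.
From mathcomp Require Import classical_sets reals Rstruct complex boolp.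
From mathcomp Require Import all_boot all_order all_algebra perm ring lra zify.
From mathcomp Require mpoly.
Import Order.TTheory GRing.Theory Num.Theory.
Local Open Scope ring_scope.

Set Implicit Arguments.
Unset Strict Implicit.
Unset Printing Implicit Defensive.

(* Swapping two values of a permutation that maximizes the number of [i] with
   [~~ N i (s i)] cannot improve it: if [N i (s i)], then every [j] has [j] or
   [s j] in the class of [i]. *)
Lemma perm_or_large_class (n : nat) (N : rel 'I_n) :
  symmetric N -> transitive N ->
  (exists s : 'S_n, forall i, ~~ N i (s i)) \/
  (exists j, N j j /\ (n < 2 * #|[set i | N j i]|)%N).
Proof.
move=> Nsym Ntr.
pose F (s : 'S_n) := #|[set i | ~~ N i (s i)]|.
have [s _ smax] := @arg_maxnP _ (1%g : 'S_n) xpredT F isT.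
have [/existsP [i Nisi]|/existsPn H] := boolP [exists i, N i (s i)]; last by left; exists s.
right.
have Nii : N i i by apply: (Ntr _ _ _ Nisi); rewrite Nsym.
exists i; split=> //.
have cov j : (j != i) ==> N i j || N i (s j).
  apply/implyP => ji; apply: contraT; rewrite negb_or => /andP [nij nisj].
  pose s' := (tperm i j * s)%g.
  have s'i : s' i = s j by rewrite permM tpermL.
  have s'j : s' j = s i by rewrite permM tpermR.
  have s'k k : k != i -> k != j -> s' k = s k.
    by move=> ki kj; rewrite permM tpermD // eq_sym.
  suff : (F s < F s')%N by rewrite ltnNge; have := smax s' isT; rewrite /= => ->.
  apply: proper_card; apply/properP; split.
    apply/subsetP => k; rewrite !inE => Hk.
    have [->|ki] := eqVneq k i; first by rewrite s'i.
    have [->|kj] := eqVneq k j; last by rewrite s'k.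
    rewrite s'j; apply: contra nij => Nj.
    by apply: (Ntr _ _ _ Nisi); rewrite Nsym.
  by exists i; rewrite !inE ?s'i ?Nisi.
set B := [set k | N i k].
have iB : i \in B by rewrite inE.
have Bs : #|s @^-1: B| = #|B| by apply: card_preimset; apply: perm_inj.
have : (B :|: (s @^-1: B)) = [set: 'I_n].
  apply/setP => j; rewrite !inE.
  have [->|ji] := eqVneq j i; first by rewrite Nii.
  by have := cov j; rewrite ji.
move/(congr1 (fun S : {set 'I_n} => #|S|)); rewrite cardsT card_ord => cn.
have : (0 < #|B :&: s @^-1: B|)%N by apply/card_gt0P; exists i; rewrite !inE Nii.
have := cardsUI B (s @^-1: B); rewrite cn Bs; lia.
Qed.

(** * Nonnegativity by averaging, and attained infima *)

Lemma sum_set_complement (n : nat) (B : {set 'I_n}) (F : 'I_n -> int) :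
  \sum_j F j = \sum_(j in B) F j + \sum_(j in ~: B) F j.
Proof.
rewrite (bigID (mem B)) /=; congr (_ + _).
by apply: eq_bigl => j; rewrite inE.
Qed.

Lemma sumz_const (T : finType) (B : {set T}) (x : int) :
  \sum_(i in B) x = #|B|%:Z * x.
Proof. by rewrite sumr_const -mulr_natl natz. Qed.

Lemma sum_pairs_ge0 (n : nat) (B C : {set 'I_n}) (D : int) (F G : 'I_n -> int) :
  (forall s t, s \in B -> t \in C -> 0 <= D + F s + G t) ->
  0 <= #|B|%:Z * #|C|%:Z * D + #|C|%:Z * (\sum_(s in B) F s)
       + #|B|%:Z * (\sum_(t in C) G t).
Proof.
move=> H.
have : 0 <= \sum_(s in B) \sum_(t in C) (D + F s + G t).
  by apply: sumr_ge0 => s sB; apply: sumr_ge0 => t tC; apply: H.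
rewrite (eq_bigr (fun s => #|C|%:Z * (D + F s) + \sum_(t in C) G t)); last first.
  by move=> s _; rewrite big_split /= sumz_const.
rewrite big_split /= -mulr_sumr big_split /= !sumz_const.
by congr (_ <= _); ring.
Qed.

(** The expression is affine in [p], hence nonnegative between two points where it is nonnegative.
    It serves to pass from the ends of an edge to the lattice points on it. *)
Lemma scaled_ge0 (a b p q : int) :
  0 <= a -> 0 <= a + q * b -> 0 <= p <= q -> 0 <= a + p * b.
Proof.
move=> a0 aq /andP [p0 pq]; have [b0|b0] := leP 0 b.
  by rewrite addr_ge0 // mulr_ge0.
apply: le_trans aq _; rewrite lerD2l; rewrite -subr_ge0 -mulrBl.
by apply: mulr_le0; lia.
Qed.

Lemma inf_attained (S : set Rl) (x : Rl) : S x -> (forall y, S y -> x <= y) -> inf S = x.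
Proof.
move=> Sx Hx; apply/eqP; rewrite eq_le; apply/andP; split.
  by apply: ge_inf => //; exists x.
by apply: lb_le_inf; [exists x|].
Qed.

(** * Convex hulls and faces *)

Lemma conv_in d (S : seq 'rV[Rl]_d) x : x \in S -> conv S x.
Proof.
move=> xS; have iS : (index x S < size S)%N by rewrite index_mem.
exists (fun l => (l == Ordinal iS)%:R); split=> [l||]; first exact: ler0n.
  by rewrite (bigD1 (Ordinal iS)) //= eqxx big1 ?addr0 // => l /negbTE ->.
rewrite (bigD1 (Ordinal iS)) //= eqxx scale1r nth_index // big1 ?addr0 // => l /negbTE ->.
by rewrite scale0r.
Qed.

Lemma conv_convex d (S : seq 'rV[Rl]_d) x y (t : Rl) : conv S x -> conv S y ->
  0 <= t <= 1 -> conv S (t *: x + (1 - t) *: y).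
Proof.
move=> [w [w0 w1 ->]] [w' [w'0 w'1 ->]] /andP [t0 t1].
exists (fun l => t * w l + (1 - t) * w' l); split.
- by move=> l; rewrite addr_ge0 // mulr_ge0 // subr_ge0.
- by rewrite big_split /= -!mulr_sumr w1 w'1 !mulr1 addrC subrK.
- rewrite !scaler_sumr -big_split; apply: eq_bigr => l _ /=.
  by rewrite !scalerA scalerDl.
Qed.

Lemma dotR_sum d (u : 'rV[Rl]_d) (I : finType) (w : I -> Rl) (F : I -> 'rV[Rl]_d) :
  dotR u (\sum_l w l *: F l) = \sum_l w l * dotR u (F l).
Proof.
under [RHS]eq_bigr do rewrite mulr_sumr.
rewrite exchange_big; apply: eq_bigr => j _ /=; rewrite summxE mulr_sumr.
by apply: eq_bigr => l _; rewrite mxE mulrCA.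
Qed.

Lemma conv_ge d (S : seq 'rV[Rl]_d) (u : 'rV[Rl]_d) x (k : Rl) :
  (forall y, y \in S -> k <= dotR u y) -> conv S x -> k <= dotR u x.
Proof.
move=> H [w [w0 w1 ->]]; rewrite dotR_sum -[k]mul1r -w1 mulr_suml.
by apply: ler_sum => l _; rewrite ler_wpM2l // H // mem_nth.
Qed.

(** A face of a convex hull is determined by the generators it contains. Each generator in [S'] has
    a partner in [S] lying in the faces of the same functionals, so an equality of faces passes from
    [S] to [S']. *)
Lemma face_transfer d (S S' : seq 'rV[Rl]_d) (u u' : 'rV[Rl]_d) :
  (forall y, y \in S' -> exists2 y', y' \in S & forall v,
     face (conv S) v y' <-> face (conv S') v y) ->
  face (conv S) u = face (conv S) u' ->
  forall x, face (conv S') u x -> face (conv S') u' x.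
Proof.
move=> H eS x [[w [w0 w1 xE]] xmin].
have xS (l : 'I_(size S')) : dotR u x <= dotR u S'`_l.
  by apply: xmin; apply: conv_in; rewrite mem_nth.
(* A sum of nonnegative terms vanishes, so every generator of nonzero weight in [x] is itself
   minimal for [u]. *)
have sum0 : \sum_l w l * (dotR u S'`_l - dotR u x) = 0.
  under eq_bigr do rewrite mulrBr.
  by rewrite sumrB -mulr_suml w1 mul1r -dotR_sum -xE subrr.
have wS (l : 'I_(size S')) : w l != 0 -> face (conv S') u' S'`_l.
  move=> wl; have lS : S'`_l \in S' by rewrite mem_nth.
  have [y' _ Hy'] := H _ lS; apply/Hy'; rewrite -eS; apply/Hy'.
  split; first exact: conv_in.
  have /eqP : w l * (dotR u S'`_l - dotR u x) = 0.
    by apply: (psumr_eq0P _ sum0) => // k _; rewrite mulr_ge0 ?subr_ge0.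
  rewrite mulf_eq0 (negbTE wl) subr_eq0 /= => /eqP Sx y Qy.
  by rewrite Sx; apply: xmin.
split; first by exists w.
move=> y Qy; rewrite xE dotR_sum -[X in _ <= X]mul1r -w1 mulr_suml.
apply: ler_sum => l _; have [->|wl] := eqVneq (w l) 0; first by rewrite !mul0r.
by rewrite ler_wpM2l //; apply: (wS l wl).2.
Qed.

(** * The local structure at a vertex *)

(* [D i] is the lattice distance of the vertex to the facet [i] and [R i j] the
   pairing of the normal of [i] with the edge direction [E_j]. The facet
   [h] of [neighbour] is the one met at the end of the edge along [E_j]. *)
Section LocalStructure.
Variables (n r c : nat) (D : 'I_r -> int) (R : 'I_r -> 'I_n -> int).
Variable f : 'I_n -> 'I_r.
Hypothesis Rf : forall l j, R (f l) j = (l == j)%:Z.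
Hypothesis Df : forall l, D (f l) = 0.
Hypothesis D_ge0 : forall i, 0 <= D i.
Hypothesis D_eq0 : forall i, D i = 0 -> exists l, f l = i.
(** [D h] is the lattice length of the edge. The inequalities place in the polytope its far end and
    the points one step from there along the other edges, whose directions are [E_t + R h t E_j];
    the last clause lists the facets through the far end. *)
Hypothesis neighbour : forall j, exists h,
  [/\ R h j = -1, 0 < D h, forall i, 0 <= D i + D h * R i j,
      forall t i, t != j -> 0 <= D i + R i t + (D h + R h t) * R i j
    & forall i, D i + D h * R i j = 0 -> i = h \/ exists2 l, l != j & f l = i].
Hypothesis edge_ge0 : forall i j, 0 <= D i + R i j.
Hypothesis codeg_min : forall (k : nat) (x : 'I_n -> int), (k < c)%N ->
  ~ forall i, 1 <= k%:Z * D i + \sum_j x j * R i j.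
Hypothesis codeg_pt : exists x : 'I_n -> int,
  forall i, 1 <= c%:Z * D i + \sum_j x j * R i j.
Hypothesis codeg_big : (n + 3 <= 2 * c)%N.

Let sum_f l (x : 'I_n -> int) : \sum_j x j * R (f l) j = x l.
Proof.
rewrite (bigD1 l) //= big1 ?addr0 => [|j jl]; first by rewrite Rf eqxx mulr1.
by rewrite Rf eq_sym (negbTE jl) mulr0.
Qed.

(** Since [2 * (c - 1) > n], such an [x] would give an interior lattice point of the [(c - 1)]-fold
    dilate: facets through the vertex have slack [x l], the others gain from [D i >= 1]. *)
Let no_half_point (x : 'I_n -> int) : (forall j, 1 <= x j) ->
  ~ forall i, 0 <= n%:Z * D i + 2 * \sum_j x j * R i j.
Proof.
move=> x1 H; apply: (@codeg_min c.-1 x); first by lia.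
move=> i; have [D0|Dn0] := eqVneq (D i) 0.
  by have [l <-] := D_eq0 D0; rewrite sum_f Df mulr0 add0r.
have Di1 : 1 <= D i by have := D_ge0 i; lia.
have := H i; set S := \sum_j _ => HS.
suff : 1 <= 2 * (c.-1%:Z * D i + S) by lia.
have : 1 <= (2 * c.-1%:Z - n%:Z) * D i by apply: mulr_ege1; lia.
lia.
Qed.

(* [v + E_i + E_j] is not in [P]. *)
Let N (i j : 'I_n) := ~~ [forall k, 0 <= D k + R k i + R k j].

Let Nsym : symmetric N.
Proof.
by move=> i j; congr (~~ _); apply: eq_forallb => k; rewrite addrAC.
Qed.

Let notN i j k : ~~ N i j -> 0 <= D k + R k i + R k j.
Proof. by move/negPn/forallP. Qed.

(** The single facet [h] decides the relation. If [R h i > - D h], the edge from [v + E_i] in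
    direction [E_j] has length at least 1, so [v + E_i + E_j] is in the polytope; for [i = j], the
    edge itself has length at least 2. *)
Let NP j h : R h j = -1 -> 0 < D h -> (forall i, 0 <= D i + D h * R i j) ->
  (forall t i, t != j -> 0 <= D i + R i t + (D h + R h t) * R i j) ->
  forall i, N j i = (R h i <= - D h).
Proof.
move=> Rhj Dh Hv Hw i; apply/idP/idP; last first.
  by move=> Hi; apply/forallPn; exists h; rewrite Rhj; lia.
case/forallPn => k; rewrite -ltNge => Hk.
have [ij|ij] := eqVneq i j.
  subst i; rewrite Rhj leNgt; apply/negP => lt.
  by have := scaled_ge0 (p := 2) (D_ge0 k) (Hv k); lia.
rewrite leNgt; apply/negP => lt.
by have := scaled_ge0 (p := 1) (edge_ge0 k i) (Hw i k ij); lia.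
Qed.

(** With [h] taken at the middle index, both related indices satisfy [R h _ <= - D h]; adding the
    two inequalities makes [h] exclude the sum of these edge directions. *)
Let Ntr : transitive N.
Proof.
move=> y x z; rewrite Nsym => Nyx Nyz.
have [h [Rhj Dh Hv Hw _]] := neighbour y.
move: Nyx Nyz; rewrite !(NP Rhj Dh Hv Hw) => Hx Hz.
by apply/forallPn; exists h; lia.
Qed.

Lemma local_structure : exists h (B : {set 'I_n}),
  [/\ D h = 1, forall j, R h j = - (j \in B)%:Z, #|B|.+1 = c,
      forall s t i, s \in B -> t \notin B -> 0 <= D i + R i s + R i t
    & forall i, 1 <= c%:Z * D i + \sum_j R i j].
Proof.
have [[s Hs]|[j0 [Njj cB]]] := perm_or_large_class Nsym Ntr.
  case: (@no_half_point (fun _ => 1)) => // i.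
  have : 0 <= \sum_j (D i + R i j + R i (s j)).
    by apply: sumr_ge0 => j _; apply: notN.
  have sE : \sum_j R i (s j) = \sum_j R i j.
    by rewrite [RHS](reindex_inj (h := s) perm_inj).
  rewrite big_split big_split /= sE sumr_const card_ord -[_ *+ n]mulr_natl natz.
  rewrite [X in _ -> _ <= _ + 2 * X](eq_bigr (R i)) => [|j _]; last exact: mul1r.
  by move: (\sum_j R i j) => S; rewrite mulrDl mul1r addrA.
have [h [Rhj Dh Hv Hw Hu]] := neighbour j0.
have NE := NP Rhj Dh Hv Hw.
set B := [set i | N j0 i] in cB.
have inB i : (i \in B) = (R h i <= - D h) by rewrite inE NE.
have Dh1 : D h = 1 by move: Njj; rewrite NE Rhj; lia.
have adj s t i : s \in B -> t \notin B -> 0 <= D i + R i s + R i t.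
  rewrite !inE => sB tB; apply: notN; apply: contra tB => /(Ntr _) ; exact.
have RhB s : s \in B -> R h s = -1.
  by rewrite inB; have := edge_ge0 h s; lia.
have Rht t : t \notin B -> 0 <= R h t by rewrite inB; lia.
have cC : (#|B| + #|~: B| = n)%N by rewrite cardsC card_ord.
have split1 i : \sum_j R i j = \sum_(j in B) R i j + \sum_(j in ~: B) R i j.
  exact: sum_set_complement.
have pairs i := @sum_pairs_ge0 n B (~: B) (D i) (R i) (R i).
(* The first case, a nonzero coordinate of the normal of [h] outside [B], ends in a contradiction
   with [no_half_point]. *)
have [[t [tB Rt]]|noq] := pselect (exists t, t \notin B /\ 1 <= R h t).
  (* All [s] in [B] share the facet [h]. The edge from [v + E_t] in direction [E_s] ends on it and
     has length [D h + R h t >= 2], so [v + E_t + 2 E_s] is in the polytope. *)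
  have two s i : s \in B -> 0 <= D i + R i t + 2 * R i s.
    move=> sB; have [h' [Rh's Dh' Hv' Hw' Hu']] := neighbour s.
    have Nss : N s s.
      by move: sB; rewrite inE => sB; apply: (Ntr (y := j0)); rewrite // Nsym.
    have Dh'1 : D h' = 1 by move: Nss; rewrite (NP Rh's Dh' Hv' Hw') Rh's; lia.
    have hh' : h = h'.
      have [|//|[l _ fl]] := Hu' h; first by rewrite Dh'1 Dh1 RhB.
      by move: Dh1; rewrite -fl Df.
    have ts : t != s by apply: contraNneq tB => ->.
    have := scaled_ge0 (p := 2) (edge_ge0 i t) (Hw' t i ts).
    by rewrite -hh' Dh1; apply; lia.
  set C := ~: B :\ t.
  have cC' : (#|C|.+1 = #|~: B|)%N by rewrite (cardsD1 t (~: B)) inE tB.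
  have pairs' i : 0 <= #|B|%:Z * #|C|%:Z * D i + #|C|%:Z * (\sum_(s in B) R i s)
       + #|B|%:Z * (\sum_(t in C) R i t).
    apply: sum_pairs_ge0 => s u sB; rewrite !inE => /andP [_ uB].
    by apply: adj => //; rewrite inE.
  have doubles i : 0 <= #|B|%:Z * (D i + R i t) + 2 * \sum_(s in B) R i s.
    rewrite mulr_sumr -sumz_const -big_split /=.
    by apply: sumr_ge0 => s sB; apply: two.
  (* Half of [#|B| - #|C|], rounded up, is the coordinate at [t]; it is positive because
     [#|C| + 1 < #|B|]. *)
  pose m : int := (uphalf (#|B| - #|C|))%:Z.
  case: (@no_half_point (fun j => if j == t then m else 1)) => [j|i].
    by case: ifP => // _; rewrite /m; lia.
  have -> : \sum_j (if j == t then m else 1) * R i j =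
     \sum_(j in B) R i j + \sum_(j in C) R i j + m * R i t.
    rewrite (sum_set_complement B) (big_setD1 (A := ~: B) t) /=; last by rewrite inE.
    rewrite eqxx -addrA [X in _ = _ + X]addrC; congr (_ + (_ + _)).
      apply: eq_bigr => j jB; rewrite ifN ?mul1r //.
      by apply: contraNneq tB => <-.
    by apply: eq_bigr => j; rewrite !inE => /andP [/negbTE -> _]; rewrite mul1r.
  have := pairs' i; have := doubles i; have := edge_ge0 i t.
  set S := \sum_(s in B) _; set S' := \sum_(s in C) _ => Ht Hd Hp.
  have lCB : (#|C| <= #|B|)%N by lia.
  have lB : (0 < #|B|)%N by lia.
  (* Twice [pairs'] plus [#|B| - #|C|] times [doubles], divided by [#|B|]. *)
  have key : 0 <= (#|B|%:Z + #|C|%:Z) * D i + 2 * S + 2 * S'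
             + (#|B|%:Z - #|C|%:Z) * R i t.
    rewrite -(pmulr_rge0 _ (x := #|B|%:Z)); last by lia.
    have : 0 <= 2 * (#|B|%:Z * #|C|%:Z * D i + #|C|%:Z * S + #|B|%:Z * S')
      + (#|B|%:Z - #|C|%:Z) * (#|B|%:Z * (D i + R i t) + 2 * S).
      apply: addr_ge0; first by apply: mulr_ge0.
      by apply: mulr_ge0 => //; lia.
    by lia.
  have nE : n%:Z = #|B|%:Z + #|C|%:Z + 1 by lia.
  (* [e] is the rounding error in [2 * m]; the leftover [D i + e * R i t] is nonnegative at the
     vertex ([e = 0]) and one step along [E_t] ([e = 1]). *)
  have [e me] : exists e : int, (e = 0 \/ e = 1) /\ 2 * m = #|B|%:Z - #|C|%:Z + e.
    exists (odd (#|B| - #|C|))%:Z; rewrite /m; split; last by lia.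
    by case: odd; [right|left].
  have -> : n%:Z * D i + 2 * (S + S' + m * R i t) =
     ((#|B|%:Z + #|C|%:Z) * D i + 2 * S + 2 * S'
             + (#|B|%:Z - #|C|%:Z) * R i t) + (D i + e * R i t).
    have -> : 2 * (S + S' + m * R i t) = 2 * S + 2 * S' + (2 * m) * R i t by ring.
    by rewrite me.2 nE; ring.
  apply: addr_ge0 => //.
  by case: me.1 => ->; rewrite ?mul0r ?mul1r ?addr0.
have Rh j : R h j = - (j \in B)%:Z.
  have [jB|jB] := boolP (j \in B); first by rewrite RhB.
  have := Rht j jB; have : ~ 1 <= R h j by move=> H; apply: noq; exists j.
  by rewrite /= oppr0; lia.
have full i : 0 <= #|B|%:Z * D i + \sum_j R i j.
  have ones : 0 <= #|B|%:Z * D i + \sum_(s in B) R i s.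
    by rewrite -sumz_const -big_split; apply: sumr_ge0 => s sB; apply: edge_ge0.
  have lB : (0 < #|B|)%N by lia.
  have lCB : (#|~: B| <= #|B|)%N by lia.
  rewrite -(pmulr_rge0 _ (x := #|B|%:Z)); last by lia.
  have : 0 <= #|B|%:Z * #|~: B|%:Z * D i + #|~: B|%:Z * (\sum_(s in B) R i s)
       + #|B|%:Z * (\sum_(t in ~: B) R i t).
    by apply: pairs => s u sB; rewrite inE => uB; apply: adj.
  have : 0 <= (#|B|%:Z - #|~: B|%:Z) * (#|B|%:Z * D i + \sum_(s in B) R i s).
    by apply: mulr_ge0 => //; lia.
  move=> H1 H2; have := addr_ge0 H1 H2; rewrite split1.
  by lia.
have strict i : 1 <= #|B|.+1%:Z * D i + \sum_j R i j.
  have [D0|Dn0] := eqVneq (D i) 0.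
    have [l <-] := D_eq0 D0; rewrite Df mulr0 add0r.
    have := sum_f l (fun _ => 1); under eq_bigr do rewrite mul1r.
    by move=> ->.
  have := full i; have := D_ge0 i; lia.
(* [strict] gives an interior lattice point of the [(#|B| + 1)]-fold dilate. Conversely, an interior
   point of the [c]-fold dilate has all coordinates at least 1, and the facet [h] bounds the sum of
   those in [B] by [c - 1]. *)
have cE : #|B|.+1 = c.
  apply/eqP; rewrite eqn_leq; apply/andP; split; last first.
    rewrite leqNgt; apply/negP => lt; apply: (codeg_min (x := fun _ => 1) lt) => i.
    by under eq_bigr do rewrite mul1r.
  have [x Hx] := codeg_pt; have := Hx h; rewrite Dh1 mulr1.
  have -> : \sum_j x j * R h j = - \sum_(j in B) x j.
    rewrite (sum_set_complement B) [X in _ + X]big1 ?addr0 -?sumrN.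
      by apply: eq_bigr => j jB; rewrite Rh jB mulrN1.
    by move=> j; rewrite inE Rh => /negbTE ->; rewrite oppr0 mulr0.
  have : #|B|%:Z <= \sum_(j in B) x j.
    rewrite -[X in X <= _]mulr1 -sumz_const; apply: ler_sum => j _.
    by have := Hx (f j); rewrite Df mulr0 add0r sum_f.
  by lia.
exists h, B; split=> //; by rewrite -cE.
Qed.
End LocalStructure.

(** * Vertices, edges and slacks *)

Definition dotI (d : nat) (u z : 'rV[int]_d) : int := \sum_(j < d) u 0 j * z 0 j.

Lemma dotID d (u x y : 'rV[int]_d) : dotI u (x + y) = dotI u x + dotI u y.
Proof. by rewrite -big_split; apply: eq_bigr => j _; rewrite mxE mulrDr. Qed.

Lemma dotIZ d (u x : 'rV[int]_d) k : dotI u (k *: x) = k * dotI u x.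
Proof. by rewrite mulr_sumr; apply: eq_bigr => j _; rewrite mxE mulrCA. Qed.

Lemma dotIN d (u x : 'rV[int]_d) : dotI u (- x) = - dotI u x.
Proof. by rewrite -scaleN1r dotIZ mulN1r. Qed.

Lemma dotI_sum d (u : 'rV[int]_d) (I : finType) (F : I -> 'rV[int]_d) :
  dotI u (\sum_i F i) = \sum_i dotI u (F i).
Proof.
rewrite exchange_big; apply: eq_bigr => j _ /=.
by rewrite summxE mulr_sumr.
Qed.

Lemma dotZD d (u : 'rV[int]_d) x y : dotZ u (x + y) = dotZ u x + dotZ u y.
Proof. by rewrite -big_split; apply: eq_bigr => j _; rewrite mxE mulrDr. Qed.

Lemma dotZZ d (u : 'rV[int]_d) k x : dotZ u (k *: x) = k * dotZ u x.
Proof. by rewrite mulr_sumr; apply: eq_bigr => j _; rewrite mxE mulrCA. Qed.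

Lemma dotZN d (u : 'rV[int]_d) x : dotZ u (- x) = - dotZ u x.
Proof. by rewrite -scaleN1r dotZZ mulN1r. Qed.

Lemma dotZ_sum d (u : 'rV[int]_d) (I : finType) (F : I -> 'rV[Rl]_d) :
  dotZ u (\sum_i F i) = \sum_i dotZ u (F i).
Proof.
rewrite exchange_big; apply: eq_bigr => j _ /=.
by rewrite summxE mulr_sumr.
Qed.

Lemma dotZ_int d (u z : 'rV[int]_d) : dotZ u (intRV z) = (dotI u z)%:~R.
Proof.
by rewrite rmorph_sum; apply: eq_bigr => j _; rewrite mxE rmorphM.
Qed.

Lemma intRV_inj d : injective (@intRV d).
Proof.
move=> x y /rowP xy; apply/rowP => j; have := xy j.
by rewrite !mxE => /intr_inj.
Qed.

Lemma intRVD d (x y : 'rV[int]_d) : intRV (x + y) = intRV x + intRV y.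
Proof. exact: map_mxD. Qed.

Lemma intRVZ d k (x : 'rV[int]_d) : intRV (k *: x) = k%:~R *: intRV x.
Proof. exact: map_mxZ. Qed.

Section Polytope.
Variables (n r : nat) (rho : 'I_r -> 'rV[int]_n) (a : 'I_r -> int).
Local Notation P := (Hset rho a).
Implicit Types (x y d : 'rV[Rl]_n) (z : 'rV[int]_n) (f : 'I_n -> 'I_r)
  (E : 'I_n -> 'rV[int]_n).

Definition slack i x : Rl := dotZ (rho i) x + (a i)%:~R.
Definition islack i z : int := dotI (rho i) z + a i.

Lemma slack_int i z : slack i (intRV z) = (islack i z)%:~R.
Proof. by rewrite /slack dotZ_int -intrD. Qed.

Lemma PE x : P x <-> forall i, 0 <= slack i x.
Proof.
have e i : (- (a i)%:~R <= dotZ (rho i) x) = (0 <= slack i x).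
  by rewrite -subr_ge0 opprK.
by split=> H i; [rewrite -e | rewrite e]; exact: H.
Qed.

Lemma slackD i x d : slack i (x + d) = slack i x + dotZ (rho i) d.
Proof. by rewrite /slack dotZD addrAC. Qed.

Lemma islackD i z z' : islack i (z + z') = islack i z + dotI (rho i) z'.
Proof. by rewrite /islack dotID addrAC. Qed.

Lemma slack_conv i (I : finType) (w : I -> Rl) (F : I -> 'rV[Rl]_n) :
  \sum_l w l = 1 -> slack i (\sum_l w l *: F l) = \sum_l w l * slack i (F l).
Proof.
move=> w1; rewrite /slack dotZ_sum.
under [RHS]eq_bigr do rewrite mulrDr.
rewrite big_split /= -mulr_suml w1 mul1r; congr (_ + _).
by apply: eq_bigr => l _; rewrite dotZZ.
Qed.

Hypothesis bounded : exists M : Rl, forall x, P x -> forall j, `|x 0 j| <= M.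

(** The facet hit first minimizes the ratio [T]. If no normal decreases along [d], the whole ray
    stays in [P], against boundedness. *)
Lemma ray_exit x d : P x -> d != 0 ->
  exists t : Rl, [/\ 0 <= t, P (x + t *: d) &
    exists h, dotZ (rho h) d < 0 /\ slack h (x + t *: d) = 0].
Proof.
move=> /PE Px dn0.
have sl i t : slack i (x + t *: d) = slack i x + t * dotZ (rho i) d.
  by rewrite slackD dotZZ.
have [/existsP [i0 i0d]|/existsPn Hd] := boolP [exists i, dotZ (rho i) d < 0].
  pose T i := slack i x / - dotZ (rho i) d.
  have [h hd hmin] := @arg_minP _ _ _ i0 (fun i => dotZ (rho i) d < 0) T i0d.
  have Nd i : dotZ (rho i) d < 0 -> 0 < - dotZ (rho i) d by rewrite oppr_gt0.
  exists (T h); split.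
  - by rewrite divr_ge0 // ltW // Nd.
  - apply/PE => i; rewrite sl; have [id|id] := ltP (dotZ (rho i) d) 0.
      have := hmin i id; rewrite {2}/T ler_pdivlMr ?Nd // mulrN; lra.
    by rewrite addr_ge0 // mulr_ge0 // divr_ge0 // ltW // Nd.
  - exists h; split=> //; rewrite sl /T.
    by field; rewrite lt_eqF.
case: bounded => M HM.
have [j dj] : exists j, d 0 j != 0.
  apply/existsP; apply: contraNT dn0 => /existsPn H.
  by apply/eqP/rowP => j; rewrite mxE; apply/eqP; have := H j; rewrite negbK.
have M0 : 0 <= M by apply: le_trans (HM x _ j) => //; apply/PE.
pose t := (M + `|x 0 j| + 1) / `|d 0 j|.
have t0 : 0 <= t by rewrite divr_ge0 // !addr_ge0.
have /HM/(_ j) : P (x + t *: d).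
  apply/PE => i; rewrite sl addr_ge0 // mulr_ge0 //.
  by have := Hd i; rewrite -leNgt.
rewrite !mxE => H.
have : `|t * d 0 j| <= M + `|x 0 j|.
  have -> : t * d 0 j = (x 0 j + t * d 0 j) - x 0 j by ring.
  by apply: le_trans (ler_normB _ _) _; rewrite lerD2r.
rewrite normrM (ger0_norm t0) /t divfK ?normr_eq0 //; lra.
Qed.

Definition convex_pred (C : 'rV[Rl]_n -> Prop) := forall x y t, C x -> C y ->
  0 <= t <= 1 -> C (t *: x + (1 - t) *: y).

(** Induction on the number of facets not tight at [x]: a point that is not a vertex is the interior
    point of a segment in [P], and following its line both ways until a further facet becomes tight
    writes [x] as a convex combination of simpler points. *)
Lemma polytope_minkowski (C : 'rV[Rl]_n -> Prop) : convex_pred C ->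
  (forall x, is_vertex P x -> C x) -> forall x, P x -> C x.
Proof.
move=> Cconv Cvert x Px.
have [m] := ubnP #|[set i | slack i x != 0]|.
elim: m x Px => // m IH x Px lem.
have [/Cvert //|nv] := pselect (is_vertex P x).
have [y [y' [Py Py' xE yy']]] : exists y y', [/\ P y, P y', x = 2^-1 *: (y + y') & y <> y'].
  apply: contrapT => H; apply: nv; split=> // y y' Py Py' xE.
  by apply: contrapT => yy'; apply: H; exists y, y'.
pose d := y - y'.
have dn0 : d != 0 by rewrite subr_eq0; apply/eqP.
have tight i : slack i x = 0 -> dotZ (rho i) d = 0.
  move/PE/(_ i): Py; move/PE/(_ i): Py'.
  rewrite xE /slack /d dotZZ !dotZD dotZN; lra.
have step (e : 'rV[Rl]_n) : e != 0 -> (forall i, slack i x = 0 -> dotZ (rho i) e = 0) ->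
    exists t : Rl, 0 < t /\ C (x + t *: e).
  move=> en0 et; have [t [t0 Pt [h [hd hs]]]] := ray_exit Px en0.
  have tn0 : t != 0.
    apply: contraTneq hd => t00; move: hs; rewrite t00 scale0r addr0 => /et ->.
    by rewrite ltxx.
  exists t; split; first by rewrite lt0r tn0.
  apply: IH => //; rewrite -ltnS; apply: leq_trans lem; rewrite ltnS; apply: proper_card.
  apply/properP; split.
    apply/subsetP => i; rewrite !inE; apply: contra => /eqP sx.
    by rewrite slackD dotZZ (et _ sx) sx mulr0 addr0.
  exists h; rewrite !inE ?hs ?eqxx //; apply/eqP => /et hd0.
  by rewrite hd0 ltxx in hd.
have [t1 [t10 C1]] := step d dn0 tight.
have [t2 [t20 C2]] : exists t : Rl, 0 < t /\ C (x + t *: - d).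
  apply: step; first by rewrite oppr_eq0.
  by move=> i /tight; rewrite dotZN => ->; rewrite oppr0.
have t12 : 0 < t1 + t2 by apply: addr_gt0.
have -> : x = (t2 / (t1 + t2)) *: (x + t1 *: d) + (1 - t2 / (t1 + t2)) *: (x + t2 *: - d).
  by apply/rowP => j; rewrite !mxE; field; rewrite gt_eqF.
apply: Cconv => //; rewrite divr_ge0 ?ler_pdivrMr ?mul1r ?lerDr //; exact: ltW.
Qed.

(** [f] lists the facets through the vertex, and [E] is the basis dual to their normals: the
    primitive edge directions. *)
Definition frame z f E :=
  [/\ is_vertex P (intRV z),
      forall i, islack i z = 0 <-> exists l, f l = i
    & forall l j, dotI (rho (f l)) (E j) = (l == j)%:Z].

Section Frame.
Variables (z : 'rV[int]_n) (f : 'I_n -> 'I_r) (E : 'I_n -> 'rV[int]_n).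
Hypothesis fr : frame z f E.

Lemma frame_dual l j : dotI (rho (f l)) (E j) = (l == j)%:Z.
Proof. by case: fr. Qed.

Lemma frame_inj : injective f.
Proof.
move=> l j lj; apply/eqP; have := frame_dual l l; rewrite lj frame_dual eqxx.
by case: eqVneq.
Qed.

Lemma frame_slack0 l : islack (f l) z = 0.
Proof. by case: fr => _ H _; apply/H; exists l. Qed.

Lemma frame_tight i : islack i z = 0 -> exists l, f l = i.
Proof. by case: fr => _ H _ /H. Qed.

Lemma frame_ge0 i : 0 <= islack i z.
Proof. by case: fr => [[/PE/(_ i) + _] _ _]; rewrite slack_int ler0z. Qed.

Lemma frame_complete p q : \sum_l rho (f l) 0 p * E l 0 q = (p == q)%:Z.
Proof.
pose M := \matrix_(l < n, j < n) rho (f l) 0 j.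
pose N := \matrix_(j < n, l < n) E l 0 j.
have : M *m N = 1%:M.
  apply/matrixP => l j; rewrite !mxE natz -frame_dual.
  by apply: eq_bigr => k _; rewrite !mxE.
move/mulmx1C/matrixP/(_ q p); rewrite !mxE natz eq_sym => <-.
by apply: eq_bigr => l _; rewrite !mxE mulrC.
Qed.

Lemma frame_expand x : x = \sum_l dotZ (rho (f l)) x *: intRV (E l).
Proof.
apply/rowP => q; rewrite summxE.
under eq_bigr do rewrite !mxE mulr_suml.
rewrite exchange_big /= (eq_bigr (fun p => x 0 p * (p == q)%:R)) => [|p _].
  rewrite (bigD1 q) //= eqxx mulr1 big1 ?addr0 // => p /negbTE ->.
  by rewrite mulr0.
rewrite -[_%:R](rmorph_nat (intr : int -> Rl)) natz -frame_complete rmorph_sum mulr_sumr.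
by apply: eq_bigr => l _; rewrite rmorphM /=; ring.
Qed.

Lemma frame_expandI (y : 'rV[int]_n) : y = \sum_l dotI (rho (f l)) y *: E l.
Proof.
apply: (@intRV_inj n); rewrite [LHS]frame_expand /intRV.
rewrite (raddf_sum (map_mx intr)); apply: eq_bigr => l _.
by rewrite -[RHS]/(intRV _) intRVZ dotZ_int.
Qed.

Lemma frame_retight g : injective g -> (forall l, islack (g l) z = 0) ->
  (forall i, islack i z = 0 <-> exists l, g l = i) /\ exists G, frame z g G.
Proof.
move=> ginj gz.
have /fin_all_exists [s sE] : forall l, exists l', f l' = g l.
  by move=> l; apply: frame_tight.
have sinj : injective s by move=> l l' e; apply: ginj; rewrite -!sE e.
have gt i : islack i z = 0 <-> exists l, g l = i.
  split=> [|[l <-]]; last exact: gz.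
  move=> /frame_tight [l <-]; exists (invF sinj l).
  by rewrite -sE f_invF.
split=> //; exists (E \o s); split=> //; first by case: fr.
by move=> l j; rewrite -sE frame_dual (inj_eq sinj).
Qed.
End Frame.

Hypothesis lattice : forall x, is_vertex P x -> exists z, x = intRV z.
Hypothesis smooth : smooth_polytope rho a.

Lemma vertex_frame x : is_vertex P x -> exists z f E, x = intRV z /\ frame z f E.
Proof.
move=> vx; have [z xz] := lattice vx; have [f [finj ft fdet]] := smooth vx.
set M := (X in \det X) in fdet.
(* The edge directions are the columns of the inverse of the matrix of normals, which is integral
   because the determinant is a unit. *)
exists z, f, (fun l => \row_j invmx M j l); split=> //; split; first by rewrite -xz.
  move=> i; rewrite -ft xz dotZ_int /islack -intrN; split=> [/eqP|/intr_inj ->].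
    by rewrite addr_eq0 => /eqP ->.
  by rewrite addNr.
have Mu : M \in unitmx by rewrite unitmxE; move: fdet; case: (\det M) => [] [|[|]].
move=> l j; have /matrixP/(_ l j) := mulmxV Mu; rewrite !mxE natz => <-.
by apply: eq_bigr => k _; rewrite !mxE.
Qed.

(** The edge along [E j] is followed up to the first new facet [h]. Smoothness at the far end makes
    the pairing of [h] with [E j] a unit, hence -1, and the new edge directions are obtained by
    duality. *)
Lemma frame_neighbour z f E j : frame z f E -> exists h,
  [/\ dotI (rho h) (E j) = -1, 0 < islack h z &
      frame (z + islack h z *: E j) (fun l => if l == j then h else f l)
        (fun l => if l == j then - E j else E l + dotI (rho h) (E l) *: E j)].
Proof.
move=> fr; have dual := frame_dual fr.
have vz : is_vertex P (intRV z) by case: fr.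
have En0 : intRV (E j) != 0.
  apply/eqP => E0; have := dual j j; rewrite eqxx => /(congr1 (intr : int -> Rl)).
  rewrite -dotZ_int E0 -(scale0r 0) dotZZ mul0r => /eqP.
  by rewrite eq_sym oner_eq0.
have [t [t0 Pv [h [hd hs]]]] := ray_exit vz.1 En0.
set v := intRV z + _ in Pv hs.
have sv i : slack i v = slack i (intRV z) + t * (dotI (rho i) (E j))%:~R.
  by rewrite slackD dotZZ dotZ_int.
rewrite dotZ_int ltrz0 in hd.
have hz : 0 < islack h z.
  rewrite lt0r (frame_ge0 fr) andbT; apply/eqP => /(frame_tight fr) [l lh].
  by move: hd; rewrite -lh dual; case: eqP.
have tpos : 0 < t.
  rewrite lt0r t0 andbT; apply/eqP => t00; move: hs; rewrite sv t00 mul0r addr0.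
  by rewrite slack_int => /eqP; rewrite intr_eq0 gt_eqF.
have ftight l : l != j -> slack (f l) v = 0.
  by move=> /negbTE lj; rewrite sv slack_int (frame_slack0 fr) dual lj mulr0 addr0.
(* A segment in [P] centred at [v] keeps all tight slacks constant: the [f l] with [l != j] force it
   to be parallel to [E j], and [h] then makes it trivial. *)
have vv : is_vertex P v.
  split=> // y y' /PE Py /PE Py' vE.
  have tight i : slack i v = 0 -> dotZ (rho i) (y - y') = 0.
    move: (Py i) (Py' i); rewrite vE /slack dotZD dotZZ dotZN dotZD; lra.
  have yE : y - y' = dotZ (rho (f j)) (y - y') *: intRV (E j).
    rewrite {1}(frame_expand fr (y - y')) (bigD1 j) //= big1 ?addr0 // => l lj.
    by rewrite tight ?scale0r // ftight.
  apply/eqP; rewrite -subr_eq0 yE.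
  have /eqP := tight h hs; rewrite {1}yE dotZZ dotZ_int mulf_eq0 intr_eq0 (lt_eqF hd) orbF.
  by move/eqP ->; rewrite scale0r.
have [z' vz'] := lattice vv.
set ell := islack (f j) z'.
have tE : t = ell%:~R.
  rewrite /ell -slack_int -vz' sv slack_int (frame_slack0 fr) dual eqxx.
  by rewrite add0r mulr1.
have zE : z' = z + ell *: E j.
  by apply: (@intRV_inj n); rewrite -vz' intRVD intRVZ -tE.
have ell0 : 0 < ell by rewrite -(ltr0z Rl) -tE.
have sz i : slack i v = 0 -> islack i z' = 0.
  by rewrite vz' slack_int => /eqP; rewrite intr_eq0 => /eqP.
have [w [f1 [E1 [wE fr1]]]] := vertex_frame vv.
have wz : w = z' by apply: (@intRV_inj n); rewrite -wE.
rewrite wz in fr1.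
pose g l := if l == j then h else f l.
have gz l : islack (g l) z' = 0.
  by rewrite /g; case: eqVneq => [_|lj]; apply: sz => //; apply: ftight.
have hf l : f l != h.
  by apply: contraTneq hz => <-; rewrite (frame_slack0 fr).
have ginj : injective g.
  move=> l l'; rewrite /g; case: eqVneq => [->|lj]; case: eqVneq => [->|l'j] // e.
  - by have := hf l'; rewrite -e eqxx.
  - by have := hf l; rewrite e eqxx.
  - exact: (frame_inj fr).
have [gt [G frG]] := frame_retight fr1 ginj gz.
have Rh : dotI (rho h) (E j) = -1.
  (* The dual vector [G j] is killed by every [f l] with [l != j], so it is an integral multiple of
     [E j] pairing to 1 with [h]. *)
  have GE : G j = dotI (rho (f j)) (G j) *: E j.
    rewrite {1}(frame_expandI fr (G j)) (bigD1 j) //= big1 ?addr0 // => l lj.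
    have := frame_dual frG l j; rewrite /g (negbTE lj) /= => e0.
    by rewrite e0 scale0r.
  have := frame_dual frG j j; rewrite /g !eqxx GE dotIZ => e.
  have : dotI (rho h) (E j) \is a GRing.unit.
    by apply/unitrPr; exists (dotI (rho (f j)) (G j)); rewrite mulrC.
  by move: hd; case: (dotI _ _) => [[|[|]]|[|]].
have ellE : ell = islack h z.
  have := sz h hs; rewrite zE islackD dotIZ Rh; lia.
exists h; split=> //; rewrite -ellE -zE; split=> //; first by rewrite -vz'.
move=> l k; have [lj|lj] := boolP (l == j); have [kj|kj] := boolP (k == j).
- by rewrite dotIN Rh opprK (eqP lj) (eqP kj) eqxx.
- by rewrite dotID dotIZ Rh mulrN1 subrr (eqP lj) eq_sym (negbTE kj).
- by rewrite dotIN dual (negbTE lj) oppr0 (eqP kj) (negbTE lj).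
- by rewrite dotID dotIZ !dual (negbTE lj) mulr0 addr0.
Qed.

Lemma frame_edge_ge0 z f E : frame z f E ->
  forall i j, 0 <= islack i z + dotI (rho i) (E j).
Proof.
move=> fr i j; have [h [_ h0 fr']] := frame_neighbour j fr.
rewrite -[dotI _ _]mul1r; apply: (scaled_ge0 (q := islack h z)).
- exact: frame_ge0 fr i.
- by have := frame_ge0 fr' i; rewrite islackD dotIZ.
- by rewrite ler01.
Qed.

Lemma frame_slackE z f E i x : frame z f E ->
  slack i x = (islack i z)%:~R + \sum_l slack (f l) x * (dotI (rho i) (E l))%:~R.
Proof.
move=> fr.
have -> : slack i x = slack i (intRV z) + dotZ (rho i) (x - intRV z).
  by rewrite -slackD addrC subrK.
rewrite slack_int; congr (_ + _).
rewrite [in LHS](frame_expand fr (x - _)) dotZ_sum; apply: eq_bigr => l _.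
rewrite dotZZ dotZ_int; congr (_ * _).
by rewrite -[LHS]add0r -[0](_ : slack (f l) (intRV z) = 0) -?slackD 1?addrC ?subrK //
   slack_int (frame_slack0 fr).
Qed.

(** These slacks are the barycentric coordinates of the image of [x] under the map onto the
    unimodular simplex. *)
Lemma simplex_slack_sum z f E h (B : {set 'I_n}) x : frame z f E ->
  islack h z = 1 -> (forall j, dotI (rho h) (E j) = - (j \in B)%:Z) ->
  slack h x + \sum_(s in B) slack (f s) x = 1.
Proof.
move=> fr h1 hB; rewrite (frame_slackE _ _ fr) h1 -addrA -[RHS]addr0; congr (_ + _).
rewrite (bigID (mem B)) /= [X in _ + X + _]big1 => [|l /negbTE lB]; last first.
  by rewrite hB lB oppr0 mulr0.
rewrite addr0 -big_split big1 //= => l lB.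
by rewrite hB lB mulrN1 addNr.
Qed.

Lemma dilate_vertex (p : nat) x : (0 < p)%N ->
  is_vertex (Hset rho (fun i => p%:Z * a i)) (p%:R *: x) <-> is_vertex P x.
Proof.
move=> p0; have pR : 0 < p%:R :> Rl by rewrite ltr0n.
have pn0 : p%:R != 0 :> Rl by rewrite gt_eqF.
have dil y : Hset rho (fun i => p%:Z * a i) (p%:R *: y) <-> P y.
  have e i : (- (p%:Z * a i)%:~R <= dotZ (rho i) (p%:R *: y)) =
      (- (a i)%:~R <= dotZ (rho i) y).
    by rewrite dotZZ intrM -mulrN ler_pM2l.
  by split=> H i; [rewrite -e | rewrite e]; exact: H.
split=> -[/dil Px Hx]; split=> //.
- move=> y y' Py Py' xE; apply: (scalerI pn0); apply: Hx; [exact/dil..|].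
  by rewrite xE -scalerDr !scalerA mulrC.
- move=> y y'; rewrite -[y](scalerKV pn0) -[y'](scalerKV pn0) => /dil Py /dil Py' xE.
  congr (_ *: _); apply: Hx => //; apply: (scalerI pn0).
  by rewrite xE -scalerDr !scalerA mulrC.
Qed.

(** * Fibration over a unimodular simplex *)

Section SimplexFibration.
Variables (k : nat) (F : 'I_k.+1 -> 'I_r).
Hypothesis Finj : injective F.
Hypothesis Fsum : forall z, \sum_j islack (F j) z = 1.

Lemma sum_normals_eq0 e : \sum_j dotI (rho (F j)) e = 0.
Proof.
have := Fsum (0 + e); under eq_bigr do rewrite islackD.
by rewrite big_split /= Fsum => e1; apply: (addrI 1); rewrite addr0.
Qed.

Lemma simplex_label z : (forall i, 0 <= islack i z) ->
  exists2 j, islack (F j) z = 1 & forall j', j' != j -> islack (F j') z = 0.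
Proof.
move=> z0; have [j zj] : exists j, islack (F j) z != 0.
  apply/existsP; rewrite -[[exists _, _]]negbK; apply/negP => /existsPn H.
  have := Fsum z; rewrite big1 // => j _; apply/eqP; have := H j.
  by rewrite negbK.
have := Fsum z; rewrite (bigD1 j) //=; set S := \sum_(_ | _) _ => zS.
have S0 : 0 <= S by apply: sumr_ge0.
have zj1 : islack (F j) z = 1 by have := z0 (F j); lia.
have S00 : S = 0 by lia.
exists j => // j' j'j.
exact: (psumr_eq0P (fun (i : 'I_k.+1) (_ : i != j) => z0 (F i)) S00 j'j).
Qed.

Lemma label_eq0 z j j' : (forall i, 0 <= islack i z) -> islack (F j) z = 1 ->
  j' != j -> islack (F j') z = 0.
Proof.
move=> z0 zj; have [l zl l0] := simplex_label z0.
have [-> |jl] := eqVneq j l; first exact: l0.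
by move: zj; rewrite l0.
Qed.

(** At a vertex, these are the edges that stay in its fibre; leaving a facet [F j] changes the
    label. *)
Definition fibre_dir f l := [forall j, F j != f l].

Lemma not_fibre_dir f l : ~~ fibre_dir f l -> exists j, F j = f l.
Proof. by case/forallPn => j; rewrite negbK => /eqP; exists j. Qed.

(** The edge leaving [F j'] is followed. As the normals of the [F i] sum to zero, [F j] decreases by
    1 along it and is the facet met, at distance 1. It pairs to zero with the fibre directions, so
    these do not change. *)
Lemma frame_switch z f E j j' : frame z f E -> islack (F j) z = 1 -> j' != j ->
  exists z' f' E', [/\ frame z' f' E', islack (F j') z' = 1 &
    forall l, fibre_dir f' l = fibre_dir f l /\ (fibre_dir f l -> E' l = E l)].
Proof.
move=> fr zj j'j; have z0 := frame_ge0 fr.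
have [l' fl'] := frame_tight fr (label_eq0 z0 zj j'j).
have [h [Rh h0 fr']] := frame_neighbour l' fr.
have others i l : i != j -> f l != F i -> dotI (rho (F i)) (E l) = 0.
  move=> ij; have [l2 <-] := frame_tight fr (label_eq0 z0 zj ij).
  by rewrite (inj_eq (frame_inj fr)) (frame_dual fr) eq_sym => /negbTE ->.
have Rj : dotI (rho (F j)) (E l') = -1.
  have := sum_normals_eq0 (E l'); rewrite (bigD1 j) //= (bigD1 j') //=.
  rewrite big1 => [|i /andP [ij ij']]; last first.
    by apply: others => //; rewrite fl' (inj_eq Finj) eq_sym.
  by rewrite -fl' (frame_dual fr) eqxx; lia.
have hj : islack h z = 1.
  have := frame_ge0 fr' (F j); rewrite islackD dotIZ Rj zj; lia.
have hF : h = F j.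
  have [|l] := frame_tight fr' (i := F j).
    by rewrite islackD dotIZ Rj zj hj.
  case: eqVneq => [_ ->|ll' fl] //.
  by move: zj; rewrite -fl (frame_slack0 fr).
exists (z + islack h z *: E l'); do 2 eexists; split; first exact: fr'.
  by rewrite hj scale1r islackD (label_eq0 z0 zj j'j) -fl' (frame_dual fr) eqxx.
move=> l; have [->|ll'] := eqVneq l l'.
  have nf : fibre_dir f l' = false by apply/negbTE/forallPn; exists j'; rewrite fl' eqxx.
  rewrite nf; split=> //; apply/negbTE/forallPn; exists j.
  by rewrite eqxx hF eqxx.
split; first by rewrite /fibre_dir (negbTE ll').
move=> /forallP fl; suff -> : dotI (rho h) (E l) = 0 by rewrite scale0r addr0.
have := sum_normals_eq0 (E l); rewrite (bigD1 j) //= hF big1 ?addr0 // => i ij.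
by apply: others => //; rewrite eq_sym.
Qed.

Variables (m : nat) (nu : 'I_m -> 'I_r).
Definition fibre_coord z : 'rV[int]_m := \row_t islack (nu t) z.

Variable A : seq 'rV[int]_n.
Hypothesis AP : forall z, z \in A <-> P (intRV z).

Definition face_vertices j :=
  [seq z <- A | `[< is_vertex P (intRV z) >] && (islack (F j) z == 1)].

Lemma face_verticesP j z : reflect (is_vertex P (intRV z) /\ islack (F j) z = 1)
  (z \in face_vertices j).
Proof.
rewrite mem_filter; apply: (iffP idP) => [/andP [/andP [/asboolP vz /eqP]]|[vz ->]] //.
rewrite eqxx andbT; apply/andP; split; first exact/asboolP.
by apply/AP; case: vz.
Qed.

Definition fibre_face j : seq 'rV[Rl]_m :=
  map (@intRV m) (map fibre_coord (face_vertices j)).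

Let psi (u : 'rV[Rl]_m) (e : 'rV[int]_n) : Rl := \sum_t u 0 t * (dotI (rho (nu t)) e)%:~R.

Let dotR_fibre u z e : dotR u (intRV (fibre_coord (z + e))) =
  dotR u (intRV (fibre_coord z)) + psi u e.
Proof.
rewrite -big_split; apply: eq_bigr => t _ /=.
by rewrite !mxE islackD intrD mulrDr.
Qed.

Let psiZ u (x : int) e : psi u (x *: e) = x%:~R * psi u e.
Proof. by rewrite mulr_sumr; apply: eq_bigr => t _; rewrite dotIZ intrM mulrCA. Qed.

Let psi_sum u (I : finType) (G : I -> 'rV[int]_n) : psi u (\sum_i G i) = \sum_i psi u (G i).
Proof.
rewrite exchange_big; apply: eq_bigr => t _ /=.
by rewrite dotI_sum rmorph_sum mulr_sumr.
Qed.

(** The far end of a fibre edge is a vertex with the same label, which gives necessity. Conversely,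
    another vertex of that label differs from [z] by a nonnegative combination of fibre
    directions. *)
Lemma fibre_face_minP z f E j u : frame z f E -> islack (F j) z = 1 ->
  face (conv (fibre_face j)) u (intRV (fibre_coord z)) <->
  (forall l, fibre_dir f l -> 0 <= psi u (E l)).
Proof.
move=> fr zj; have z0 := frame_ge0 fr.
have mem w : w \in face_vertices j -> conv (fibre_face j) (intRV (fibre_coord w)).
  by move=> wF; apply: conv_in; rewrite /fibre_face -map_comp; apply: map_f.
have zF : z \in face_vertices j by apply/face_verticesP; split=> //; case: fr.
split=> [[_ zmin] l /forallP fl|H].
  have [h [Rh h0 fr']] := frame_neighbour l fr.
  have Fl i : i != j -> dotI (rho (F i)) (E l) = 0.
    move=> ij; have [l2 fl2] := frame_tight fr (label_eq0 z0 zj ij).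
    rewrite -fl2 (frame_dual fr); case: eqP => // ll.
    by have := fl i; rewrite -fl2 ll eqxx.
  have Fj : dotI (rho (F j)) (E l) = 0.
    by have := sum_normals_eq0 (E l); rewrite (bigD1 j) //= big1 ?addr0.
  have /mem/zmin : z + islack h z *: E l \in face_vertices j.
    apply/face_verticesP; split; first by case: fr'.
    by rewrite islackD dotIZ Fj mulr0 addr0.
  by rewrite dotR_fibre lerDl psiZ pmulr_rge0 // ltr0z.
split; first exact: mem.
move=> y; apply: conv_ge => {}y /mapP [_ /mapP [w /face_verticesP [vw wj] ->] ->].
have -> : w = z + (w - z) by rewrite addrC subrK.
rewrite dotR_fibre lerDl (frame_expandI fr (w - z)) psi_sum.
apply: sumr_ge0 => l _; rewrite psiZ.
have w0 i : 0 <= islack i w by case: vw => /PE/(_ i); rewrite slack_int ler0z.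
have -> : dotI (rho (f l)) (w - z) = islack (f l) w.
  have := frame_slack0 fr l; rewrite dotID dotIN /islack; lia.
have [fl|/not_fibre_dir [i Fi]] := boolP (fibre_dir f l).
  by rewrite mulr_ge0 ?ler0z ?H.
have ij : i != j.
  by apply: contra_eq_neq zj => <-; rewrite Fi (frame_slack0 fr).
by rewrite -Fi (label_eq0 w0 wj ij) mul0r.
Qed.

(** By [frame_switch] each vertex over one label has a counterpart over any other with the same
    fibre directions, hence the same normal cone; [face_transfer] concludes. *)
Lemma fibre_same_normal_fan : same_normal_fan (fun j => conv (fibre_face j)).
Proof.
have transfer j j' u u' : face (conv (fibre_face j)) u = face (conv (fibre_face j)) u' ->
    forall y : 'rV[Rl]_m, face (conv (fibre_face j')) u y -> face (conv (fibre_face j')) u' y.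
  apply: face_transfer => y /mapP [_ /mapP [w wF ->] ->].
  have [vw wj] := face_verticesP _ _ wF.
  have [jj|jj] := eqVneq j j'.
    exists (intRV (fibre_coord w)) => //; last by rewrite jj.
    by rewrite jj /fibre_face -map_comp; apply: map_f.
  have [z [f [E [/intRV_inj wz fr]]]] := vertex_frame vw.
  rewrite wz in wj *.
  have [z' [f' [E' [fr' z'j Hf]]]] := frame_switch fr wj jj.
  exists (intRV (fibre_coord z')).
    rewrite /fibre_face -map_comp; apply: map_f; apply/face_verticesP.
    by split=> //; case: fr'.
  move=> v; rewrite (fibre_face_minP _ fr' z'j) (fibre_face_minP _ fr wj).
  split=> H l fl; have [ef eE] := Hf l.
    by rewrite -eE // H // ef.
  by rewrite ef in fl; rewrite eE // H.
by move=> j j' u u'; split=> e; apply/seteqP; split=> y;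
  [apply: transfer e y | apply: transfer (esym e) y | apply: transfer e y
  | apply: transfer (esym e) y].
Qed.
End SimplexFibration.

Hypothesis nonempty : exists x, P x.

Lemma frame_exists : exists z f E, frame z f E.
Proof.
case: nonempty => x Px; apply: contrapT => H.
(* Without vertices, even the empty predicate would hold on all of [P]. *)
apply: (polytope_minkowski (C := fun _ => False)) Px => // y /vertex_frame [z [f [E [_ fr]]]].
by apply: H; exists z, f, E.
Qed.

(** * Codegree and nef value *)

Variable c : nat.
Hypothesis codeg : codeg_spec rho a c.
Hypothesis codeg_big : (n + 3 <= 2 * c)%N.

Lemma interior_point k z :
  Hset rho (fun i => k%:Z * a i - 1) (intRV z) <->
  forall i, 1 <= dotI (rho i) z + k%:Z * a i.
Proof.
have e i : (- (k%:Z * a i - 1)%:~R <= dotZ (rho i) (intRV z)) =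
    (1 <= dotI (rho i) z + k%:Z * a i).
  by rewrite dotZ_int -intrN ler_int; apply/idP/idP; lia.
by split=> H i; [rewrite -e | rewrite e]; exact: H.
Qed.

Lemma frame_structure z f E : frame z f E -> exists h (B : {set 'I_n}),
  [/\ islack h z = 1, forall j, dotI (rho h) (E j) = - (j \in B)%:Z, #|B|.+1 = c,
      forall s t i, s \in B -> t \notin B ->
        0 <= islack i z + dotI (rho i) (E s) + dotI (rho i) (E t)
    & forall i, 1 <= c%:Z * islack i z + \sum_j dotI (rho i) (E j)].
Proof.
move=> fr.
have shift k (x : 'I_n -> int) i :
    dotI (rho i) (k%:Z *: z + \sum_j x j *: E j) + k%:Z * a i =
    k%:Z * islack i z + \sum_j x j * dotI (rho i) (E j).
  rewrite dotID dotIZ dotI_sum /islack mulrDr addrAC; congr (_ + _).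
  by apply: eq_bigr => j _; rewrite dotIZ.
apply: (@local_structure n r c _ _ f) => //.
- exact: frame_dual fr.
- exact: frame_slack0 fr.
- exact: frame_ge0 fr.
- exact: frame_tight fr.
- move=> j; have [h [Rh h0 fr']] := frame_neighbour j fr; exists h; split=> //.
  + by move=> i; have := frame_ge0 fr' i; rewrite islackD dotIZ.
  + move=> t i tj; have := frame_edge_ge0 fr' i t.
    rewrite (negbTE tj) islackD dotIZ dotID dotIZ; lia.
  + move=> i iz; have [|l] := frame_tight fr' (i := i).
      by rewrite islackD dotIZ.
    case: eqVneq => [_ <-|lj <-]; [by left|by right; exists l].
- exact: frame_edge_ge0 fr.
- move=> k x lt H; case: codeg => _ /(_ k lt); apply.
  exists (k%:Z *: z + \sum_j x j *: E j); apply/interior_point => i.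
  by rewrite shift.
- have [w /interior_point Hw] := codeg.1.
  exists (fun j => dotI (rho (f j)) (w - c%:Z *: z)) => i.
  by rewrite -shift -(frame_expandI fr) [_ *: z + _]addrC subrK.
Qed.

(** After division by [p], all slacks are at least [b / p], while [c] of them sum to 1. *)
Lemma codegQ_ge (p b : nat) x : (0 < p)%N -> (0 < b)%N ->
  Hset rho (fun i => p%:Z * a i - b%:Z) x -> c%:R <= p%:R / b%:R :> Rl.
Proof.
move=> p0 b0 Hx.
have [z [f [E fr]]] := frame_exists.
have [h [B [h1 hB <- _ _]]] := frame_structure fr.
have pR : 0 < p%:R :> Rl by rewrite ltr0n.
have bR : 0 < b%:R :> Rl by rewrite ltr0n.
have sx i : b%:R / p%:R <= slack i (p%:R^-1 *: x).
  rewrite /slack dotZZ ler_pdivrMr // mulrDl mulrAC mulVf ?gt_eqF // mul1r.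
  have := Hx i; rewrite intrB intrM; lra.
have := simplex_slack_sum (p%:R^-1 *: x) fr h1 hB.
have : (b%:R / p%:R) *+ #|B| <= \sum_(s in B) slack (f s) (p%:R^-1 *: x).
  by rewrite -sumr_const; apply: ler_sum => s _.
have := sx h; rewrite ler_pdivlMr // -[_ *+ #|B|]mulr_natl => H1 H2 H3.
have : #|B|.+1%:R * (b%:R / p%:R) <= 1 :> Rl.
  by rewrite -natr1 mulrDl mul1r -[X in _ <= X]H3 addrC lerD.
by rewrite mulrA ler_pdivrMr // mul1r.
Qed.

Lemma spanned_nonempty (p b : nat) : (0 < p)%N ->
  s_spanned rho (fun i => p%:Z * a i) b%:Z ->
  exists x, Hset rho (fun i => p%:Z * a i - b%:Z) x.
Proof.
move=> p0 sp; have [z [f [E fr]]] := frame_exists.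
exists (intRV (p%:Z *: z + b%:Z *: \sum_l E l)).
apply: (sp (p%:R *: intRV z)); first by apply/dilate_vertex => //; case: fr.
move=> i; rewrite dotZZ !dotZ_int -[p%:R](rmorph_nat intr) natz -rmorphM -rmorphN.
move=> /intr_inj H.
have [l il] : exists l, f l = i.
  apply: (frame_tight fr); rewrite /islack; apply/eqP.
  have pn0 : p%:Z != 0 by lia.
  by rewrite -(mulrI_eq0 _ (mulfI pn0)) mulrDr H addNr.
rewrite dotID !dotIZ H dotI_sum -il -[in RHS]intrD; congr (_ + _)%:~R.
rewrite (bigD1 l) //= big1 ?addr0 => [|k kl]; first by rewrite (frame_dual fr) eqxx mulr1.
by rewrite (frame_dual fr) eq_sym (negbTE kl).
Qed.

Lemma codegree_spanned : (0 < c)%N -> s_spanned rho (fun i => c%:Z * a i) 1.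
Proof.
move=> c0 m; have cn0 : c%:R != 0 :> Rl by rewrite pnatr_eq0 -lt0n.
rewrite -(scalerKV cn0 m) => /(dilate_vertex _ c0)/vertex_frame [z [f [E [-> fr]]]] y Hy.
have [h [B [_ _ _ _ span]]] := frame_structure fr.
have yE : y = intRV (c%:Z *: z + \sum_l E l).
  apply/eqP; rewrite -subr_eq0; apply/eqP; rewrite (frame_expand fr (y - _)).
  rewrite big1 // => l _; rewrite dotZD dotZN dotZ_int Hy; last first.
    rewrite dotZZ dotZ_int -[c%:R](rmorph_nat intr) natz -rmorphM -rmorphN.
    congr _%:~R; have := frame_slack0 fr l; rewrite /islack => /eqP.
    by rewrite addr_eq0 => /eqP ->; rewrite mulrN.
  rewrite dotID dotIZ dotI_sum (bigD1 l) //= big1 => [|k kl]; last first.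
    by rewrite (frame_dual fr) eq_sym (negbTE kl).
  have := frame_slack0 fr l; rewrite (frame_dual fr) eqxx /islack => /eqP.
  rewrite addr_eq0 => /eqP ->; rewrite addr0 mulrN intrD rmorphN /=.
  by rewrite subrr scale0r.
rewrite yE; apply/interior_point => i; rewrite dotID dotIZ dotI_sum.
have := span i; rewrite /islack; lia.
Qed.

Lemma polytope_Qnormal : Qnormal rho a.
Proof.
have [z [f [E fr]]] := frame_exists.
have [h [B [_ _ cE _ _]]] := frame_structure fr.
have c0 : (0 < c)%N by rewrite -cE.
have sp := codegree_spanned c0.
transitivity (c%:R : Rl); last symmetry; apply: inf_attained.
- exists c, 1%N; split=> //; first by rewrite divr1.
  exact: spanned_nonempty.
- by move=> y [p [b [p0 b0 -> [x Hx]]]]; apply: codegQ_ge Hx.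
- by exists c, 1%N; split=> //; rewrite divr1.
- move=> y [p [b [p0 b0 -> /(spanned_nonempty p0) [x Hx]]]].
  exact: codegQ_ge Hx.
Qed.

(** * The Cayley structure *)

Lemma polytope_cayley (A : seq 'rV[int]_n) : (forall z, z \in A <-> P (intRV z)) ->
  exists k, k.+1 = c /\ strict_cayley P k.
Proof.
move=> AP; have [z0 [f [E fr]]] := frame_exists.
have [h [B [h1 hB cE _ _]]] := frame_structure fr.
pose k := #|B|; pose m := #|~: B|.
exists k; split=> //; exists m.
(* [h] gets label 0: it is the facet of the simplex opposite to the image of [z0], so that [z0] lies
   over [cay_e ord0 = 0]. *)
pose F (j : 'I_k.+1) := if unlift ord0 j is Some s then f (enum_val s) else h.
have F0 : F ord0 = h by rewrite /F unlift_none.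
have FS s : F (lift ord0 s) = f (enum_val s) by rewrite /F liftK.
have hf l : f l != h by apply: contra_eq_neq h1 => <-; rewrite (frame_slack0 fr).
have Finj : injective F.
  move=> i j; case: (unliftP ord0 i) => [s|] ->; case: (unliftP ord0 j) => [s'|] ->;
    rewrite ?F0 ?FS => // e.
  - by rewrite (enum_val_inj (frame_inj fr e)).
  - by have := hf (enum_val s); rewrite e eqxx.
  - by have := hf (enum_val s'); rewrite e eqxx.
have Fsum z : \sum_j islack (F j) z = 1.
  apply: (@intr_inj Rl); apply: (etrans _ (simplex_slack_sum (intRV z) fr h1 hB)).
  rewrite rmorph_sum big_ord_recl F0 slack_int; congr (_ + _).
  rewrite [RHS]big_enum_val; apply: eq_bigr => s _.
  by rewrite FS slack_int.
pose nu (t : 'I_m) := f (enum_val t).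
exists (fun j => map (fibre_coord nu) (face_vertices F A j)).
have vface j : exists z, z \in face_vertices F A j.
  have [z Hz] : exists z f E, frame z f E /\ islack (F j) z = 1.
    have z00 : islack (F ord0) z0 = 1 by rewrite F0.
    have [->|j0] := eqVneq j ord0; first by exists z0, f, E.
    have [z' [f' [E' [fr' z'j _]]]] := frame_switch Finj Fsum fr z00 j0.
    by exists z', f', E'.
  case: Hz => f' [E' [fr' zj]]; exists z.
  by apply/face_verticesP => //; split=> //; case: fr'.
split.
- move=> j; have [z zj] := vface j; apply/eqP => /(congr1 size) /=.
  by rewrite size_map; case: face_vertices zj.
- exact: fibre_same_normal_fan.
(* [g] reorders the basis at [z0], fibre directions first, as in [row_mx]. *)
pose g (i : 'I_(m + k)) : 'I_n := match split i with inl t => enum_val t | inr s => enum_val s end.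
have gl t : g (lshift k t) = enum_val t.
  by rewrite /g (unsplitK (inl t)).
have gr s : g (rshift m s) = enum_val s.
  by rewrite /g (unsplitK (inr s)).
have ginj : injective g.
  move=> i j; rewrite -(splitK i) -(splitK j) /unsplit.
  case: (split i) => [t|s]; case: (split j) => [t'|s']; rewrite ?gl ?gr => e.
  - by rewrite (enum_val_inj e).
  - by have := enum_valP t; rewrite e inE enum_valP.
  - by have := enum_valP t'; rewrite -e inE enum_valP.
  - by rewrite (enum_val_inj e).
have gbij : bijective g.
  by apply: inj_card_bij => //; rewrite !card_ord addnC cardsC card_ord.
pose U := \matrix_(i < m + k, q < n) E (g i) 0 q.
pose W := \matrix_(q < n, i < m + k) rho (f (g i)) 0 q.
exists U, W, z0; split.
- apply/matrixP => i j; rewrite !mxE natz -(inj_eq ginj) eq_sym -(frame_dual fr).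
  by apply: eq_bigr => q _; rewrite !mxE mulrC.
- apply/matrixP => p q; rewrite !mxE natz -(frame_complete fr).
  by rewrite (reindex g) /=; [apply: eq_bigr => i _; rewrite !mxE | exact: onW_bij].
have UE (y : 'rV[Rl]_(m + k)) : y *m map_mx intr U = \sum_i y 0 i *: intRV (E (g i)).
  apply/rowP => q; rewrite summxE !mxE; apply: eq_bigr => i _.
  by rewrite !mxE.
(* The coordinates of [z - z0] in the edge basis are slacks: fibre coordinates outside [B], and the
   indicator of the label on [B]. *)
have vertexE z j : islack (F j) z = 1 -> (forall j', j' != j -> islack (F j') z = 0) ->
    intRV z = row_mx (intRV (fibre_coord nu z)) (cay_e j) *m map_mx intr U + intRV z0.
  move=> zj zj'; rewrite UE -[z in LHS](subrK z0) intRVD; congr (_ + _).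
  rewrite (frame_expandI fr (z - z0)) /intRV (raddf_sum (map_mx intr)).
  rewrite (reindex g) /=; last exact: onW_bij.
  apply: eq_bigr => i _; rewrite -[LHS]/(intRV _) intRVZ; congr (_ *: _).
  have -> : dotI (rho (f (g i))) (z - z0) = islack (f (g i)) z.
    by have := frame_slack0 fr (g i); rewrite dotID dotIN /islack; lia.
  rewrite -(splitK i) /unsplit; case: (split i) => [t|s].
    by rewrite row_mxEl gl !mxE.
  rewrite row_mxEr gr mxE -FS; have [jE|js] := eqVneq j (lift ord0 s).
    by rewrite -jE zj jE /= eqxx.
  rewrite zj' 1?eq_sym // ifN //.
  by apply: contra js => /eqP js; apply/eqP/val_inj; rewrite /= /bump; lia.
apply/seteqP; split=> x.
- pose C x := exists y : 'rV[Rl]_(m + k), conv (cayley_pts (fun j => map (fibre_coord nu) (face_vertices F A j))) y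
    /\ x = y *m map_mx intr U + intRV z0.
  apply: (polytope_minkowski (C := C)) => {x}.
    move=> _ _ t [y [Cy ->]] [y' [Cy' ->]] t01.
    exists (t *: y + (1 - t) *: y'); split; first exact: conv_convex.
    rewrite mulmxDl -!scalemxAl !scalerDr addrACA -scalerDl.
    by rewrite [t + _]addrC subrK scale1r.
  move=> x vx; have [z [f' [E' [xz fr']]]] := vertex_frame vx; rewrite xz in vx *.
  have [j zj zj'] := simplex_label Fsum (frame_ge0 fr').
  exists (row_mx (intRV (fibre_coord nu z)) (cay_e j)); split; last exact: vertexE.
  apply: conv_in; apply/flattenP.
  exists [seq row_mx (intRV v) (cay_e j) | v <- map (fibre_coord nu) (face_vertices F A j)].
    by apply: map_f; rewrite mem_enum.
  by apply/map_f/map_f/face_verticesP.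
- move=> [y [[w [w0 w1 ->]] ->]]; apply/PE => i.
  set S := cayley_pts _ in w w0 w1 *.
  have -> : (\sum_l w l *: S`_l) *m map_mx intr U + intRV z0 =
      \sum_l w l *: (S`_l *m map_mx intr U + intRV z0).
    rewrite mulmx_suml -[intRV z0 in LHS]scale1r -w1 scaler_suml -big_split.
    by apply: eq_bigr => l _ /=; rewrite -scalemxAl scalerDr.
  rewrite slack_conv //; apply: sumr_ge0 => l _; rewrite mulr_ge0 //.
  have /flattenP [_ /mapP [j _ ->] /mapP [_ /mapP [z zj ->] ->]] : S`_l \in S.
    by rewrite mem_nth.
  have [vz zj1] := face_verticesP F AP _ _ zj.
  have z_ge0 i' : 0 <= islack i' z by case: vz => /PE/(_ i'); rewrite slack_int ler0z.
  rewrite -vertexE ?slack_int ?ler0z // => j' j'j.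
  exact: (label_eq0 Fsum z_ge0 zj1 j'j).
Qed.
End Polytope.

(** * Algebraic independence *)

Import mpoly.

Section PolynomialDependence.
Variables (K : fieldType) (d : nat).
Implicit Types p q : {mpoly K[d]}.

Definition mdeg_le (e : nat) p := forall m, m \in msupp p -> (mdeg m <= e)%N.

Lemma mdeg_le_M e e' p q : mdeg_le e p -> mdeg_le e' q -> mdeg_le (e + e') (p * q).
Proof.
move=> Hp Hq m /msuppM_le /allpairsP [[m1 m2] /= [/Hp H1 /Hq H2 ->]].
by rewrite mdegD leq_add.
Qed.

Lemma mdeg_le_1 : mdeg_le 0 (1 : {mpoly K[d]}).
Proof. by move=> m; rewrite msupp1 inE => /eqP ->; rewrite mdeg0. Qed.

Lemma mdeg_le_X e p k : mdeg_le e p -> mdeg_le (k * e) (p ^+ k).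
Proof.
move=> He; elim: k => [|k IH]; first exact: mdeg_le_1.
by rewrite exprS mulSn; apply: mdeg_le_M.
Qed.

Lemma mdeg_le_prod (I : finType) e (F : I -> {mpoly K[d]}) :
  (forall i, mdeg_le e (F i)) -> mdeg_le (#|I| * e) (\prod_i F i).
Proof.
move=> He; rewrite cardE -[X in (X * e)%N](size_map F) -big_enum -(big_map F xpredT id).
have : forall p, p \in map F (enum I) -> mdeg_le e p by move=> p /mapP [i _ ->].
elim: (map F _) => [_|p s IH Hs]; first by rewrite big_nil; exact: mdeg_le_1.
rewrite big_cons mulSn; apply: mdeg_le_M; first by apply: Hs; rewrite mem_head.
by apply: IH => q qs; apply: Hs; rewrite inE qs orbT.
Qed.

(* There are [D ^ d.+1] products of powers [< D] of the [F i], and they live in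
   a space of dimension [D ^ d * L ^ d], where [L] does not depend on [D]. *)
Lemma mpoly_dependent (F : 'I_d.+1 -> {mpoly K[d]}) :
  exists2 p : {mpoly K[d.+1]}, p != 0 &
    forall v, p.@[fun i => (F i).@[v]] = 0.
Proof.
pose e := (\max_i msize (F i))%N.
have Fe i : mdeg_le e (F i).
  by move=> m /msize_mdeg_lt /ltnW /leq_trans; apply; apply: (leq_bigmax i).
(* [D > L ^ d] makes the [D ^ d.+1] rows outnumber the [(D * L) ^ d] columns, and [L] exceeds
   [d.+1 * e], so every exponent in a product [G al] is below [D * L]. *)
pose L := (d.+1 * e).+1; pose D := (L ^ d).+1.
pose rows := {ffun 'I_d.+1 -> 'I_D}; pose cols := {ffun 'I_d -> 'I_(D * L)}.
pose G (al : rows) := \prod_i F i ^+ al i.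
have Ge al : mdeg_le (d.+1 * (D * e)) (G al).
  rewrite -[X in (X * _)%N]card_ord; apply: mdeg_le_prod => i m mi.
  apply: leq_trans (mdeg_le_X (Fe i) mi) _.
  by rewrite leq_mul2r ltnW ?orbT.
pose mon (be : cols) : 'X_{1..d} := [multinom (be i : nat) | i < d].
pose M := \matrix_(x < #|rows|, y < #|cols|) (G (enum_val x))@_(mon (enum_val y)).
have : kermx M != 0.
  rewrite kermx_eq0 -row_leq_rank -ltnNge; apply: leq_ltn_trans (rank_leq_col M) _.
  rewrite !card_ffun !card_ord expnMn expnS mulnC ltn_mul2r expn_gt0.
  by rewrite ltnSn andbT.
case/rowV0Pn => w /sub_kermxP wM wn0.
pose mon' (al : rows) : 'X_{1..d.+1} := [multinom (al i : nat) | i < d.+1].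
have mon'_inj : injective mon'.
  move=> al al' /mnmP H; apply/ffunP => i; apply: val_inj.
  by have := H i; rewrite !mnmE.
exists (\sum_x w 0 x *: 'X_[mon' (enum_val x)]).
  have [x wx] : exists x, w 0 x != 0.
    apply/existsP; apply: contraNT wn0 => /existsPn H.
    by apply/eqP/rowP => x; rewrite mxE; apply/eqP; have := H x; rewrite negbK.
  apply: contraNneq wx => /(congr1 (mcoeff (mon' (enum_val x)))).
  rewrite mcoeff0 raddf_sum (bigD1 x) //= mcoeffZ mcoeffX eqxx mulr1.
  rewrite big1 ?addr0 => [->//|y yx].
  by rewrite mcoeffZ mcoeffX (inj_eq mon'_inj) (inj_eq enum_val_inj) (negbTE yx) mulr0.
have G0 : \sum_x w 0 x *: G (enum_val x) = 0.
  apply/mpolyP => m; rewrite mcoeff0 raddf_sum /=.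
  have [/forallP mL|/forallPn [i mi]] := boolP [forall i, m i < D * L]%N.
    pose be : cols := [ffun i => Ordinal (mL i)].
    have mE : m = mon be by apply/mnmP => i; rewrite mnmE ffunE.
    have /matrixP/(_ 0 (enum_rank be)) := wM; rewrite !mxE; apply: etrans.
    by apply: eq_bigr => x _; rewrite mcoeffZ mxE enum_rankK mE.
  rewrite big1 // => x _; rewrite mcoeffZ.
  suff /memN_msupp_eq0 -> : m \notin msupp (G (enum_val x)) by rewrite mulr0.
  apply: contra mi => /Ge me; apply: leq_ltn_trans (_ : m i <= mdeg m)%N _.
    by rewrite mdegE (bigD1 i) //= leq_addr.
  apply: leq_ltn_trans me _; rewrite mulnCA ltn_mul2l /=; exact: ltnSn.
move=> v; have := congr1 (meval v) G0.
rewrite meval0 !raddf_sum /=; apply: etrans; apply: eq_bigr => x _ /=.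
rewrite !mevalZ mevalX rmorph_prod; congr (_ * _); apply: eq_bigr => i _ /=.
by rewrite rmorphXn mnmE.
Qed.
End PolynomialDependence.

Section PolynomialVanishing.
Variables (K : numFieldType) (N : nat).
Implicit Types p q : {mpoly K[N]}.

(* Scaling one coordinate by 2 and subtracting kills a monomial. *)
Lemma mpoly_torus_eq0 p :
  (forall v, (forall i, v i != 0) -> p.@[v] = 0) -> p = 0.
Proof.
have [s] := ubnP (size (msupp p)); elim: s p => // s IH p ps Hp.
have [->//|pn0] := eqVneq p 0.
have m1p : mlead p \in msupp p by rewrite mlead_supp.
set m1 := mlead p in m1p.
have [[m2 [m2p m12]]|single] := pselect (exists m2, m2 \in msupp p /\ m2 != m1).
  have [i mi] : exists i, m2 i != m1 i.
    apply/existsP; apply: contraNT m12 => /existsPn H.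
    by apply/eqP/mnmP => i; apply/eqP; have := H i; rewrite negbK.
  (* [q] is [p] with its variable [i] doubled, minus [2 ^+ m1 i] times [p]; it loses [m1], but keeps
     [m2]. *)
  pose w (m : 'X_{1..N}) : K := 2 ^+ m i - 2 ^+ m1 i.
  pose q := \sum_(m <- msupp p) (p@_m * w m) *: 'X_[m].
  have qE m : q@_m = p@_m * w m.
    rewrite raddf_sum /=; have [mp|mp] := boolP (m \in msupp p).
      rewrite (bigD1_seq m) ?msupp_uniq //= mcoeffZ mcoeffX eqxx mulr1.
      rewrite big1 ?addr0 // => k km.
      by rewrite mcoeffZ mcoeffX (negbTE km) mulr0.
    rewrite (memN_msupp_eq0 mp) mul0r big_seq big1 // => k kp.
    rewrite mcoeffZ mcoeffX; case: eqVneq => [km|]; last by rewrite mulr0.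
    by rewrite -km kp in mp.
  have q0 : q = 0.
    apply: IH.
      rewrite -ltnS; apply: leq_trans ps; rewrite ltnS.
      have sub : {subset msupp q <= rem m1 (msupp p)}.
        move=> m; rewrite mcoeff_msupp qE mulf_eq0 negb_or => /andP [pm wm].
        rewrite (mem_rem_uniq _ (msupp_uniq p)) inE mcoeff_msupp pm andbT.
        by apply: contraNneq wm => ->; rewrite /w subrr.
      have := uniq_leq_size (msupp_uniq q) sub; rewrite size_rem //.
      by case: (msupp p) m1p => // x t _ /=; rewrite ltnS.
    move=> v v0; pose v' j := if j == i then 2 * v j else v j.
    have -> : q.@[v] = p.@[v'] - 2 ^+ m1 i * p.@[v].
      rewrite {1}/q raddf_sum ![p.@[_]]mevalE mulr_sumr -sumrB /=; apply: eq_bigr => m _.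
      rewrite mevalZ mevalX (bigD1 i) //= [in RHS](bigD1 i) //=.
      rewrite /v' eqxx exprMn [X in _ = _ * (_ * X) - _](eq_bigr (fun j => v j ^+ m j)).
        rewrite /w; move: (2 ^+ m i) (2 ^+ m1 i) (v i ^+ m i) (\prod_(j | _) _) => x y z t.
        by ring.
      by move=> j /negbTE ->.
    rewrite !Hp ?mulr0 ?subr0 // => j; rewrite /v'; case: ifP => // _.
    by rewrite mulf_neq0 ?pnatr_eq0.
  have /eqP := qE m2; rewrite q0 mcoeff0 eq_sym mulf_eq0 -[_ == 0]negbK -mcoeff_msupp m2p /=.
  by rewrite subr_eq0 => /eqP /ieexprIn e; case/eqP: mi; apply: e; rewrite ?ltr0n // pnatr_eq1.
have pE : p = p@_m1 *: 'X_[m1].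
  apply/mpolyP => m; rewrite mcoeffZ mcoeffX; case: eqVneq => [->|mm1]; first by rewrite mulr1.
  rewrite mulr0; apply: memN_msupp_eq0; apply/negP => mp.
  by apply: single; exists m; split=> //; rewrite eq_sym.
have := Hp (fun _ => 1) (fun _ => oner_neq0 _).
rewrite pE mevalZ mevalX big1 ?mulr1 => [->|i _]; first by rewrite scale0r.
by rewrite expr1n.
Qed.

(* Comparing top coefficients in the scaled variables: dividing by the largest
   power of [l] turns the family into a polynomial in [1 / l], evaluated at 0. *)
Lemma mpoly_scaling_eq0 p (T : pred 'I_N) :
  (forall v, (forall i, v i != 0) -> exists w : 'I_N -> K, forall l : K, l != 0 ->
     p.@[fun i => if T i then l * v i + w i else v i] = 0) -> p = 0.
Proof.
move=> Hp; apply/eqP; apply: contraT => pn0.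
pose wd (m : 'X_{1..N}) := (\sum_(i | T i) m i)%N.
have [m0 m0p m0max] : exists2 m0, m0 \in msupp p & forall m, m \in msupp p -> (wd m <= wd m0)%N.
  have lp : mlead p \in msupp p by rewrite mlead_supp.
  pose x0 : seq_sub (msupp p) := SeqSub lp.
  have [x _ xmax] := @arg_maxnP _ x0 xpredT (fun x => wd (ssval x)) isT.
  exists (ssval x); first exact: ssvalP.
  by move=> m mp; apply: (xmax (SeqSub mp)).
pose e := wd m0.
pose q := \sum_(m <- msupp p) (if wd m == e then p@_m else 0) *: 'X_[m].
suff q0 : q = 0.
  have : q@_m0 = 0 by rewrite q0 mcoeff0.
  rewrite raddf_sum /= (bigD1_seq m0) ?msupp_uniq //= mcoeffZ mcoeffX !eqxx mulr1.
  rewrite big1 ?addr0 => [/eqP|k km].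
    by rewrite -[_ == 0]negbK -mcoeff_msupp m0p.
  by rewrite mcoeffZ mcoeffX (negbTE km) mulr0.
apply: mpoly_torus_eq0 => v v0; have [w Hw] := Hp v v0.
(* For [x != 0], [R.[x]] is [x ^+ e] times the value of [p] at [l = 1 / x]. It vanishes at more
   points than its degree allows, and [R.[0]] is the value of [q] at [v]. *)
pose R : {poly K} := \sum_(m <- msupp p) p@_m *: ('X^(e - wd m) *
  \prod_i ((v i)%:P + (if T i then w i *: 'X else 0)) ^+ m i).
have RE x : R.[x] = \sum_(m <- msupp p) p@_m * (x ^+ (e - wd m) *
  \prod_i (v i + (if T i then w i * x else 0)) ^+ m i).
  rewrite horner_sum; apply: eq_bigr => m _.
  rewrite hornerZ hornerM hornerXn horner_prod; congr (_ * (_ * _)).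
  apply: eq_bigr => i _; rewrite horner_exp hornerD hornerC.
  by case: ifP => _; rewrite ?hornerZ ?hornerX ?horner0.
have R0 : R = 0.
  apply/eqP; apply: contraT => Rn0.
  pose s := [seq (k.+1%:R : K) | k <- iota 0 (size R)].
  have := @max_poly_roots K R s Rn0.
  rewrite size_map size_iota ltnn; apply; last first.
    by rewrite map_inj_uniq ?iota_uniq // => a b /eqP; rewrite eqr_nat eqSS => /eqP.
  apply/allP => _ /mapP [k _ ->]; have : k.+1%:R != 0 :> K by rewrite pnatr_eq0.
  move: (k.+1%:R) => x xn0.
  have xV : x^-1 != 0 by rewrite invr_eq0.
  have /(congr1 ( *%R (x ^+ e))) := Hw _ xV; rewrite mulr0 mevalE mulr_sumr => pE.
  apply/eqP; rewrite RE; apply: etrans pE.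
  rewrite big_seq [RHS]big_seq; apply: eq_bigr => m mp.
  rewrite [RHS]mulrCA; congr (_ * _).
  rewrite -[e in RHS](subnK (m0max m mp)) -/e exprD -mulrA; congr (_ * _).
  rewrite /wd -prodrXr [in RHS]big_mkcond -big_split; apply: eq_bigr => i _ /=.
  case: ifP => _; last by rewrite addr0 mul1r.
  by rewrite -exprMn mulrDr mulrA divff // mul1r [x * w i]mulrC.
have := RE 0; rewrite R0 horner0 => R00.
rewrite /q raddf_sum /=; apply: etrans (esym R00).
rewrite big_seq [RHS]big_seq; apply: eq_bigr => m mp; rewrite mevalZ mevalX.
have lem := m0max m mp.
case: ifP => [/eqP we|we]; last first.
  by rewrite expr0n subn_eq0 -/e leqNgt ltn_neqAle we lem mul0r mul0r mulr0.
rewrite we subnn expr0 mul1r; congr (_ * _).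
by apply: eq_bigr => i _; case: ifP => _; rewrite ?mulr0 addr0.
Qed.
End PolynomialVanishing.

(** * The dimension of the dual variety *)

Lemma sum_fibres (R : pzRingType) (I J : finType) (C : {set J}) (g : J -> I)
    (c : J -> R) (h : I -> R) :
  \sum_i (\sum_(t | (t \in C) && (g t == i)) c t) * h i = \sum_(t in C) c t * h (g t).
Proof.
rewrite [RHS](partition_big g xpredT) //=; apply: eq_bigr => i _.
by rewrite mulr_suml; apply: eq_bigr => t /andP [_ /eqP ->].
Qed.

Section DualDimension.
(** [G l] is the exponent vector of the [l]-th monomial at a vertex, with simplex variables indexed
    by [B] and fibre variables by its complement. The indices [l0], [ls s], [lt t], [lst s t] stand
    for [1], [sg s], [sg t], [sg s * sg t]. *)
Variables (M n : nat) (B : {set 'I_n}) (G : 'I_M -> 'I_n -> nat).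
Variables (l0 : 'I_M) (ls lt : 'I_n -> 'I_M) (lst : 'I_n -> 'I_n -> 'I_M).
Hypothesis G_le1 : forall l, (\sum_(s in B) G l s <= 1)%N.
Hypothesis G_inj : forall l l', G l =1 G l' -> l = l'.
Hypothesis G0 : forall i, G l0 i = 0%N.
Hypothesis Gs : forall s i, s \in B -> G (ls s) i = (i == s).
Hypothesis Gt : forall t i, t \notin B -> G (lt t) i = (i == t).
Hypothesis Gst : forall s t i, s \in B -> t \notin B ->
  G (lst s t) i = ((i == s) || (i == t)).

Definition torus_monomial (sg : 'I_n -> Cx) l := \prod_i sg i ^+ G l i.
Definition fibre_monomial (sg : 'I_n -> Cx) l := \prod_(t in ~: B) sg t ^+ G l t.
Let chi := torus_monomial.
Let fm := fibre_monomial.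

Definition tangent_cone : set ('I_M -> Cx) := [set xi | exists sg : 'I_n -> Cx,
  [/\ forall i, sg i != 0, \sum_l xi l * chi sg l = 0
    & forall i, \sum_l xi l * (G l i)%:R * chi sg l = 0]].

(** The classes of [same] collect the monomials of one fibre polynomial [f_j]; [Z] picks from each
    class its monomial without fibre variables. *)
Let same l l' := [forall s in B, G l s == G l' s].
Let Z := [set l | [forall t in ~: B, G l t == 0%N]].

Let sameP l l' : reflect (forall s, s \in B -> G l s = G l' s) (same l l').
Proof.
apply: (iffP forall_inP) => H s sB; first exact/eqP/H.
by apply/eqP/H.
Qed.

Let ZP l : reflect (forall t, t \notin B -> G l t = 0%N) (l \in Z).
Proof.
rewrite inE; apply: (iffP forall_inP) => H t tB; first by apply/eqP/H; rewrite inE.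
by apply/eqP/H; rewrite inE in tB.
Qed.

Let Z_same l l' : l \in Z -> l' \in Z -> same l l' -> l = l'.
Proof.
move=> /ZP lZ /ZP l'Z /sameP H; apply: G_inj => i.
by have [/H|iB] := boolP (i \in B); rewrite // lZ // l'Z.
Qed.

Let l0Z : l0 \in Z. Proof. by apply/ZP. Qed.

Let lsZ s : s \in B -> ls s \in Z.
Proof. by move=> sB; apply/ZP => t tB; rewrite Gs //; case: eqP tB sB => // -> /negbTE ->. Qed.

Let G_others l s s' : s \in B -> s' \in B -> s' != s -> G l s != 0%N -> G l s' = 0%N.
Proof.
move=> sB s'B ss' ls0; have := G_le1 l.
rewrite (bigD1 s) //= (bigD1 s') /=; last by rewrite s'B.
lia.
Qed.

Let same_ls l s : s \in B -> G l s = same l (ls s) :> nat.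
Proof.
move=> sB; have [/sameP H|] := boolP (same l (ls s)); first by rewrite H // Gs // eqxx.
apply: contraNeq => ls0; apply/sameP => s' s'B; rewrite Gs //.
have [->|ss'] := eqVneq s' s; last exact: G_others ls0.
have := G_le1 l; rewrite (bigD1 s) //=; lia.
Qed.

Let same_l0 l : (\sum_(s in B) G l s + same l l0 = 1)%N.
Proof.
have [/sameP H|nl] := boolP (same l l0).
  by rewrite big1 // => s sB; rewrite H // G0.
have [s sB ls0] : exists2 s, s \in B & G l s != 0%N.
  apply/exists_inP; apply: contraNT nl => /exists_inPn H.
  by apply/sameP => s sB; rewrite G0; apply/eqP; have := H s sB; rewrite negbK.
have := G_le1 l; rewrite (bigD1 s) //=; lia.
Qed.

Let chiE sg l : chi sg l = (\prod_(s in B) sg s ^+ G l s) * fm sg l.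
Proof.
rewrite /chi /torus_monomial (bigID (mem B)) /=; congr (_ * _).
by apply: eq_bigl => i; rewrite inE.
Qed.

Let chi_ls sg l s : s \in B -> (G l s)%:R * chi sg l = (same l (ls s))%:R * (sg s * fm sg l).
Proof.
move=> sB; rewrite same_ls //; have [sl|_] := boolP (same l (ls s)); last by rewrite !mul0r.
rewrite !mul1r chiE (bigD1 s) //= same_ls // sl expr1 big1 ?mulr1 // => s' /andP [s'B ss'].
by rewrite (G_others (s := s)) // same_ls // sl.
Qed.

Let chi_l0 sg l : (same l l0)%:R * chi sg l = (same l l0)%:R * fm sg l.
Proof.
have [/sameP sl|_] := boolP (same l l0); last by rewrite !mul0r.
by rewrite chiE big1 ?mul1r // => s sB; rewrite sl // G0.
Qed.

(** For a polynomial [f_0] plus the sum of the [s_j f_j], the derivative along [s_j] gives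
    [f_j = 0], and [f = 0] then leaves [f_0 = 0]. *)
Let tangent_coneE xi : tangent_cone xi <-> exists sg : 'I_n -> Cx,
  [/\ forall i, sg i != 0,
      forall z, z \in Z -> \sum_(l | same l z) xi l * fm sg l = 0
    & forall t, t \notin B -> \sum_l xi l * (G l t)%:R * chi sg l = 0].
Proof.
have class_s sg s : s \in B -> \sum_l xi l * (G l s)%:R * chi sg l =
    sg s * \sum_(l | same l (ls s)) xi l * fm sg l.
  move=> sB; rewrite mulr_sumr [RHS]big_mkcond; apply: eq_bigr => l _.
  rewrite -mulrA chi_ls //; case: ifP => _; last by rewrite mul0r mulr0.
  by rewrite mul1r mulrCA.
have class_0 sg : \sum_l xi l * chi sg l =
    \sum_(s in B) (\sum_l xi l * (G l s)%:R * chi sg l) + \sum_(l | same l l0) xi l * fm sg l.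
  rewrite exchange_big [X in _ = _ + X]big_mkcond -big_split; apply: eq_bigr => l _ /=.
  have -> : (if same l l0 then xi l * fm sg l else 0) = xi l * ((same l l0)%:R * chi sg l).
    by rewrite chi_l0; case: ifP; rewrite ?mul1r ?mul0r ?mulr0.
  rewrite -mulr_suml -mulr_sumr -natr_sum !mulrA -mulrDl -mulrDr -natrD.
  by rewrite same_l0 mulr1.
have Zcase z : z \in Z -> z = l0 \/ exists2 s, s \in B & z = ls s.
  move=> zZ; have [zl|] := boolP (same z l0); first by left; apply: Z_same.
  move=> nz; right.
  have [s sB zs0] : exists2 s, s \in B & G z s != 0%N.
    apply/exists_inP; apply: contraNT nz => /exists_inPn H.
    by apply/sameP => s sB; rewrite G0; apply/eqP; have := H s sB; rewrite negbK.
  exists s => //; apply: Z_same => //; first exact: lsZ.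
  by move: zs0; rewrite same_ls //; case: same.
split=> -[sg [sg0]].
  move=> H0 Hi; exists sg; split=> // z /Zcase [->|[s sB ->]].
    by move: H0; rewrite class_0 big1 ?add0r // => s sB; apply: Hi.
  have /eqP := Hi s; rewrite class_s // mulf_eq0 (negbTE (sg0 s)) /=.
  by move/eqP.
move=> HZ Ht; have Hs s : s \in B -> \sum_l xi l * (G l s)%:R * chi sg l = 0.
  by move=> sB; rewrite class_s // HZ ?mulr0 // lsZ.
exists sg; split=> //; first by rewrite class_0 HZ // addr0 big1.
by move=> i; have [/Hs|/Ht] := boolP (i \in B).
Qed.

Let cardZ : #|Z| = #|B|.+1.
Proof.
have ZE : Z = l0 |: [set ls s | s in B].
  apply/setP => z; rewrite !inE; apply/idP/idP => [zZ|/orP [/eqP ->|/imsetP [s sB ->]]].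
  - have {}zZ : z \in Z by rewrite inE.
    have [zl|nz] := boolP (same z l0); first by rewrite (Z_same zZ l0Z zl) eqxx.
    have [s sB zs0] : exists2 s, s \in B & G z s != 0%N.
      apply/exists_inP; apply: contraNT nz => /exists_inPn H.
      by apply/sameP => s sB; rewrite G0; apply/eqP; have := H s sB; rewrite negbK.
    apply/orP; right; apply/imsetP; exists s => //; apply: Z_same => //; first exact: lsZ.
    by move: zs0; rewrite same_ls //; case: same.
  - by have := l0Z; rewrite inE.
  - by have := lsZ sB; rewrite inE.
rewrite ZE cardsU1 card_in_imset => [|s s' sB s'B e].
  suff -> : l0 \notin [set ls s | s in B] by [].
  apply/imsetP => -[s sB e]; have := G0 s; by rewrite e Gs // eqxx.
have := Gs s sB; rewrite e Gs // eqxx; by case: eqP.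
Qed.

Let d := (#|~: Z| + #|~: B|)%N.

(** Each equation [f_j = 0] is solved for its constant coefficient, the coordinate in [Z]. So the
    cone lies in the image of a polynomial map from [d] parameters: the other coordinates and the
    fibre variables. *)
Lemma tangent_cone_upper : ~ coord_indep tangent_cone d.+1.
Proof.
move=> [f [_ Hf]].
pose XI l : {mpoly Cx[d]} := \sum_(x < #|~: Z| | enum_val x == l) 'X_(lshift #|~: B| x).
pose XM l : {mpoly Cx[d]} := \prod_(y < #|~: B|) 'X_(rshift #|~: Z| y) ^+ G l (enum_val y).
pose F l := if l \in Z then - \sum_(l' | (l' \notin Z) && same l' l) XI l' * XM l' else XI l.
have Fpar xi : tangent_cone xi -> exists th : 'I_d -> Cx, forall l, xi l = (F l).@[th].
  move=> /tangent_coneE [sg [sg0 HZ _]].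
  pose th (i : 'I_d) := match split i with
    inl x => xi (enum_val x) | inr y => sg (enum_val y) end.
  have thl x : th (lshift _ x) = xi (enum_val x) by rewrite /th (unsplitK (inl x)).
  have thr x : th (rshift _ x) = sg (enum_val x) by rewrite /th (unsplitK (inr x)).
  have XIE l : l \notin Z -> (XI l).@[th] = xi l.
    move=> lZ; rewrite raddf_sum /= (eq_bigr (fun x => xi (enum_val x))) => [|x _].
      rewrite -(big_enum_val_cond (fun x => x == l) xi).
      rewrite (big_pred1 l) // => x /=; rewrite inE.
      by case: eqVneq => [->|]; rewrite ?lZ ?andbF.
    by rewrite mevalXU thl.
  have XME l : (XM l).@[th] = fm sg l.
    rewrite rmorph_prod /fm /fibre_monomial [RHS]big_enum_val.
    by apply: eq_bigr => y _; rewrite rmorphXn /= mevalXU thr.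
  exists th => l; rewrite /F; case: ifP => lZ; last by rewrite XIE // lZ.
  have := HZ l lZ; rewrite (bigD1 l) /=; last by apply/sameP.
  have -> : fm sg l = 1.
    by apply: big1 => t; rewrite inE => /(ZP _ lZ) ->; rewrite expr0.
  rewrite mulr1 => /eqP; rewrite addr_eq0 => /eqP ->.
  rewrite rmorphN; congr (- _); rewrite raddf_sum; apply: eq_big => l'.
    have [sl|_] := boolP (same l' l); last by rewrite andbF.
    rewrite andbT; congr (~~ _); apply/eqP/idP => [->//|l'Z].
    exact: Z_same.
  move=> /andP [sl l'l]; rewrite /= mevalM XME XIE //.
  by apply: contra l'l => l'Z; apply/eqP; apply: Z_same.
have [p pn0 Hp] := mpoly_dependent (fun i => F (f i)).
case/eqP: pn0; apply: Hf => xi /Fpar [th xiE].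
by rewrite -(Hp th); apply: meval_eq => i; rewrite xiE.
Qed.

Hypothesis small : (#|~: B| <= #|B|)%N.

(** For fixed [sg] the cone contains a linear space. By [mpoly_scaling_eq0] it suffices to find
    lines in the cone with a prescribed direction in the scaled coordinates and prescribed values in
    the other kept ones. *)
Lemma tangent_cone_lower : coord_indep tangent_cone d.
Proof.
(* [small] provides an injection [j] of the fibre variables into the simplex variables. *)
pose j t := nth t (enum B) (index t (enum (~: B))).
have index_lt t : t \notin B -> (index t (enum (~: B)) < size (enum B))%N.
  move=> tB; rewrite -cardE; apply: leq_trans small; rewrite cardE index_mem mem_enum.
  by rewrite inE.
have jB t : t \notin B -> j t \in B.
  by move=> tB; rewrite -mem_enum mem_nth // index_lt.
have jinj t t' : t \notin B -> t' \notin B -> j t = j t' -> t = t'.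
  move=> tB t'B; rewrite /j (set_nth_default t') ?index_lt // => /eqP.
  rewrite nth_uniq ?index_lt ?enum_uniq // => /eqP e.
  have inC u : u \notin B -> u \in enum (~: B) by rewrite mem_enum inE.
  by rewrite -(nth_index t (inC t tB)) e nth_index // inC.
pose aa t := ls (j t); pose bb t := lst (j t) t.
pose kept := ~: Z :|: [set aa t | t in ~: B].
have aainj : {in ~: B &, injective aa}.
  move=> t t'; rewrite !inE => tB t'B e; apply: jinj => //.
  have := Gs (j t) (jB t tB); rewrite -/(aa t) e Gs ?jB // eqxx.
  by case: eqP.
have aaZ t : t \notin B -> aa t \in Z by move=> tB; apply/lsZ/jB.
have ckept : #|kept| = d.
  rewrite cardsU card_in_imset // (_ : _ :&: _ = finset.set0) ?cards0 ?subn0 //.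
  apply/setP => l; rewrite in_setI in_setC in_set0; apply/negP => /andP [lZ /imsetP [t]].
  by rewrite inE => tB le; rewrite le aaZ in lZ.
rewrite -ckept; exists enum_val; split; first exact: enum_val_inj.
move=> p Hp.
pose isb l := [exists t in ~: B, l == bb t].
pose isx l := [exists t in ~: B, l == lt t].
pose isa l := [exists t in ~: B, l == aa t].
have tC t : t \notin B -> t \in ~: B by rewrite inE.
have bbt t i : t \notin B -> i \notin B -> G (bb t) i = (i == t).
  move=> tB iB; rewrite Gst ?jB //; case: eqVneq => // e.
  by rewrite e jB in iB.
have bbs t s : t \notin B -> s \in B -> G (bb t) s = (s == j t).
  move=> tB sB; rewrite Gst ?jB // orbC; case: eqVneq => // e.
  by rewrite -e sB in tB.
have bbZ t : t \notin B -> bb t \notin Z.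
  by move=> tB; apply/negP => /ZP /(_ t tB); rewrite bbt // eqxx.
have ltZ t : t \notin B -> lt t \notin Z.
  by move=> tB; apply/negP => /ZP /(_ t tB); rewrite Gt // eqxx.
have ltbb t t' : t \notin B -> t' \notin B -> lt t != bb t'.
  move=> tB t'B; apply/eqP => e; have := bbs t' (j t') t'B (jB t' t'B).
  rewrite -e Gt // eqxx; case: eqVneq => // e2.
  by have := jB t' t'B; rewrite e2 (negbTE tB).
apply: (mpoly_scaling_eq0 (T := fun i => [|| isa (enum_val i), isb (enum_val i) | isx (enum_val i)])) => v v0.
pose V l := \sum_(i < #|kept| | enum_val i == l) v i.
have VE i : V (enum_val i) = v i.
  by rewrite /V (big_pred1 i) // => i'; rewrite /= (inj_eq enum_val_inj).
have V0 l : l \in kept -> V l != 0.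
  by move=> lk; rewrite -(enum_rankK_in lk lk) VE.
have aak t : t \notin B -> aa t \in kept.
  by move=> tB; rewrite inE imset_f ?orbT // tC.
have nZk l : l \notin Z -> l \in kept by rewrite in_setU in_setC => ->.
(* The terms linear in [lam] force these values: the class equation of [aa t] gives
   [V (aa t) + V (bb t) * tau t = 0], the derivative along [t] gives
   [V (lt t) + V (bb t) * sg (j t) = 0]. *)
pose tau t := - (V (aa t) / V (bb t)).
pose sg i := if i \in B then
    (if [pick t in ~: B | j t == i] is Some t then - (V (lt t) / V (bb t)) else 1)
  else tau i.
have sgt t : t \notin B -> sg t = tau t by move=> tB; rewrite /sg (negbTE tB).
have sgj t : t \notin B -> sg (j t) = - (V (lt t) / V (bb t)).
  move=> tB; rewrite /sg jB //; case: pickP => [t'|/(_ t)]; last by rewrite tC // eqxx.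
  by rewrite inE => /andP [t'B /eqP /jinj ->].
have sg0 i : sg i != 0.
  rewrite /sg /tau; case: ifP => iB; last first.
    by rewrite oppr_eq0 mulf_neq0 ?invr_eq0 ?V0 ?aak ?nZk ?bbZ ?iB.
  case: pickP => [t|_]; last exact: oner_neq0.
  by rewrite inE => /andP [tB _]; rewrite oppr_eq0 mulf_neq0 ?invr_eq0 ?V0 ?nZk ?bbZ ?ltZ.
have fm_bb t : t \notin B -> fm sg (bb t) = tau t.
  move=> tB; rewrite /fm /fibre_monomial (bigD1 t) ?tC //= bbt // eqxx expr1 sgt //.
  rewrite big1 ?mulr1 // => t'; rewrite inE => /andP [t'B /negbTE tt'].
  by rewrite bbt // tt' expr0.
have chi_bb t : t \notin B -> chi sg (bb t) = sg (j t) * tau t.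
  move=> tB; have := chi_ls sg (bb t) (jB t tB).
  by rewrite -(same_ls (bb t) (jB t tB)) bbs ?jB // eqxx !mul1r fm_bb.
have chi_lt t : t \notin B -> chi sg (lt t) = tau t.
  move=> tB; rewrite /chi /torus_monomial (bigD1 t) //= Gt // eqxx expr1 sgt //.
  by rewrite big1 ?mulr1 // => t' /negbTE tt'; rewrite Gt // tt' expr0.
have isbb t : t \notin B -> isb (bb t).
  by move=> tB; apply/exists_inP; exists t; rewrite ?tC.
(* [Y] is [lam * V] at the [bb t] and 0 on [Z] and at the [lt t]. Then [cc] solves the derivative
   equation of [t] for the coordinate [lt t], and [xi] solves the class equations for the
   coordinates in [Z]. *)
pose Y0 l := if [|| l \in Z, isx l | isb l] then 0 else V l.
pose Y lam l := (if isb l then lam * V l else 0) + Y0 l.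
pose cc lam t := - (tau t)^-1 * \sum_l Y lam l * (G l t)%:R * chi sg l.
pose Y1 lam l := Y lam l + \sum_(t | (t \in ~: B) && (lt t == l)) cc lam t.
pose xi lam l := if l \in Z then
    - \sum_(l' | (l' \notin Z) && same l' l) Y1 lam l' * fm sg l' else Y1 lam l.
have xi_in lam : tangent_cone (xi lam).
  apply/tangent_coneE; exists sg; split=> //.
    move=> z zZ; rewrite (bigD1 z) /=; last by apply/sameP.
    have -> : fm sg z = 1.
      by apply: big1 => t; rewrite inE => /(ZP _ zZ) ->; rewrite expr0.
    rewrite mulr1 {1}/xi zZ; apply/eqP; rewrite addrC subr_eq0; apply/eqP.
    have pE l : same l z && (l != z) = (l \notin Z) && same l z.
      have [sl|_] := boolP (same l z); last by rewrite andbF.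
      by rewrite andbT; congr (~~ _); apply/eqP/idP => [->//|lZ]; apply: Z_same.
    by apply: eq_big => // l; rewrite pE => /andP [/negbTE lZ _]; rewrite /xi lZ.
  move=> t tB.
  rewrite (eq_bigr (fun l => Y1 lam l * ((G l t)%:R * chi sg l))) => [|l _]; last first.
    rewrite /xi; case: ifP => [lZ|_]; last by rewrite mulrA.
    by rewrite (ZP _ lZ) // mul0r !mulr0 mul0r.
  rewrite /Y1; under eq_bigr do rewrite mulrDl.
  rewrite big_split /= sum_fibres (bigD1 t) ?tC //=.
  rewrite [X in _ + (_ + X)]big1 ?addr0 => [|t']; last first.
    rewrite inE => /andP [t'B tt']; rewrite Gt // eq_sym (negbTE tt').
    by rewrite mul0r mulr0.
  rewrite Gt // eqxx mul1r chi_lt // /cc mulrAC mulNr mulVf ?mulN1r -?sgt //.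
  by under eq_bigr do rewrite mulrA; rewrite subrr.
have Yb lam t (Pd : pred 'I_M) (h : 'I_M -> Cx) : t \notin B -> Pd (bb t) ->
    (forall t', t' \notin B -> t' != t -> Pd (bb t') -> h (bb t') = 0) ->
    \sum_(l | Pd l) Y lam l * h l = lam * V (bb t) * h (bb t) + \sum_(l | Pd l) Y 0 l * h l.
  move=> tB Pt Ht.
  rewrite (eq_bigr (fun l => (if isb l then lam * V l else 0) * h l + Y 0 l * h l)).
    rewrite big_split /=; congr (_ + _); rewrite (bigD1 (bb t)) //= isbb // big1 ?addr0 //.
    move=> l /andP [Pl lt']; case: ifP => [|_]; last by rewrite mul0r.
    case/exists_inP => t'; rewrite inE => t'B /eqP lE; rewrite lE in Pl lt' *.
    by rewrite Ht ?mulr0 //; apply: contraNneq lt' => ->.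
  by move=> l _; rewrite -mulrDl /Y mul0r if_same add0r.
pose w (i : 'I_#|kept|) := xi 0 (enum_val i).
exists w => lam _; rewrite -(Hp _ (xi_in lam)); apply: meval_eq => i /=.
rewrite /w -VE; have := enum_valP i; set l := enum_val i => lk.
have nlt lam' l' : (forall t, t \notin B -> lt t != l') -> Y1 lam' l' = Y lam' l'.
  move=> H; rewrite /Y1 big1 ?addr0 // => t; rewrite inE => /andP [tB].
  by rewrite (negbTE (H t tB)).
have ltl lam' t : t \notin B -> Y1 lam' (lt t) = cc lam' t.
  move=> tB; rewrite /Y1 (big_pred1 t) => [|t' /=]; last first.
    rewrite inE; apply/andP/eqP => [[t'B /eqP e]|->]; last by rewrite tB eqxx.
    by have := Gt t' tB; rewrite -e Gt // eqxx; case: eqP.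
  have e1 : isb (lt t) = false.
    apply/negbTE/exists_inP => -[t']; rewrite inE => t'B; exact/negP/ltbb.
  have e2 : isx (lt t) by apply/exists_inP; exists t; rewrite ?tC.
  by rewrite /Y /Y0 e1 e2 orbT addr0 add0r.
have [/exists_inP [t]|na] := boolP (isa l).
  rewrite inE => tB /eqP lE; rewrite lE /xi aaZ //=.
  (* [lt t'] lies in the class of [l0], so the corrections [cc] do not enter the class equation of
     [aa t]. *)
  have clt t' : t' \notin B -> ~~ same (lt t') (aa t).
    move=> t'B; apply/negP => /sameP /(_ (j t) (jB t tB)).
    by rewrite /aa Gs ?jB // eqxx Gt //; case: eqVneq => // e; rewrite -e jB in t'B.
  have sum_Y lam' : \sum_(l' | (l' \notin Z) && same l' (aa t)) Y1 lam' l' * fm sg l' =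
      \sum_(l' | (l' \notin Z) && same l' (aa t)) Y lam' l' * fm sg l'.
    apply: eq_bigr => l' /andP [_ sl]; rewrite nlt // => t' t'B.
    by apply: contraTneq sl => <-; apply: clt.
  rewrite !sum_Y (Yb lam t) //.
  - rewrite fm_bb // opprD; congr (_ - _); rewrite /tau mulrN opprK -mulrA; congr (_ * _).
    by rewrite mulrC divfK // V0 // nZk // bbZ.
  - rewrite bbZ //=; apply/sameP => s sB; rewrite bbs // Gs ?jB //.
  - move=> t' t'B tt' /andP [_ /sameP /(_ (j t') (jB t' t'B))].
    rewrite bbs ?jB // eqxx Gs ?jB //; case: eqVneq => // /(jinj t' t t'B tB) e.
    by rewrite e eqxx in tt'.
have lZ : l \notin Z.
  move: lk; rewrite in_setU in_setC => /orP [//|/imsetP [t tB lE]].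
  by case/negP: na; apply/exists_inP; exists t => //; rewrite lE.
rewrite /xi (negbTE lZ).
have [/exists_inP [t]|nb] := boolP (isb l).
  rewrite inE => tB /eqP lE; rewrite !nlt; last 2 first.
  - by move=> t' t'B; rewrite lE ltbb.
  - by move=> t' t'B; rewrite lE ltbb.
  rewrite /Y /Y0 lE isbb // !orbT /= !addr0 mul0r addr0 //.
have [/exists_inP [t]|nx] := boolP (isx l).
  rewrite inE => tB /eqP lE; rewrite lE !ltl //=.
  have ccE lam' : cc lam' t = - (tau t)^-1 *
      (lam' * V (bb t) * (sg (j t) * tau t) + \sum_l Y 0 l * ((G l t)%:R * chi sg l)).
    rewrite /cc; under eq_bigr do rewrite -mulrA.
    rewrite (Yb lam' t) //; first by rewrite bbt // eqxx mul1r chi_bb.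
    by move=> t' t'B tt' _; rewrite bbt // eq_sym (negbTE tt') mul0r.
  rewrite !ccE mul0r mul0r add0r [RHS]mulrDr; congr (_ + _).
  have tn0 : tau t != 0 by rewrite -sgt.
  have Vn0 : V (bb t) != 0 by rewrite V0 // nZk // bbZ.
  rewrite sgj //; move: (tau t) (V (bb t)) (V (lt t)) tn0 Vn0 => x y z x0 y0.
  by field; rewrite x0 y0.
rewrite /= nlt => [|t tB]; last first.
  by apply: contraNneq nx => <-; apply/exists_inP; exists t; rewrite ?tC.
by rewrite /Y /Y0 (negbTE nb) (negbTE nx) (negbTE lZ) add0r.
Qed.

Lemma tangent_cone_zdim : exists dc, zdim tangent_cone dc /\
  (dc + #|B|.+1 = M + #|~: B|)%N.
Proof.
exists d; split; first by split; [exact: tangent_cone_lower | exact: tangent_cone_upper].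
by have := cardsC Z; rewrite card_ord cardZ /d; lia.
Qed.
End DualDimension.

(** * Laurent monomials and the change to vertex coordinates *)

Section LaurentMonomials.
Variables (n : nat) (t : 'I_n -> Cx).
Hypothesis t0 : forall j, t j != 0.

Lemma lmono0 : lmono 0 t = 1.
Proof. by apply: big1 => j _; rewrite mxE. Qed.

Lemma lmonoD x y : lmono (x + y) t = lmono x t * lmono y t.
Proof. by rewrite -big_split; apply: eq_bigr => j _; rewrite mxE expfzDr. Qed.

Lemma lmonoZ k x : lmono (k *: x) t = lmono x t ^ k.
Proof.
rewrite [RHS](big_morph (fun u : Cx => u ^ k) (id1 := 1) (op1 := *%R)).
- by apply: eq_bigr => j _; rewrite mxE mulrC exprz_exp.
- by move=> x' y'; rewrite expfzMl.
- exact: exp1rz.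
Qed.

Lemma lmono_sum (I : finType) (F : I -> 'rV[int]_n) :
  lmono (\sum_i F i) t = \prod_i lmono (F i) t.
Proof.
apply: (big_rec2 (fun x y => lmono x t = y)) => [|i y x _ <-]; first exact: lmono0.
exact: lmonoD.
Qed.

Lemma lmono_neq0 x : lmono x t != 0.
Proof. by apply/prodf_neq0 => j _; rewrite expfz_neq0. Qed.
End LaurentMonomials.

Section ToricDual.
Variables (n r : nat) (rho : 'I_r -> 'rV[int]_n) (a : 'I_r -> int).
Variables (z : 'rV[int]_n) (f : 'I_n -> 'I_r) (E : 'I_n -> 'rV[int]_n).
Hypothesis fr : frame rho a z f E.
Variable A : seq 'rV[int]_n.
Hypothesis A_ge0 : forall l : 'I_(size A), forall i, 0 <= islack rho a i A`_l.

Let G (l : 'I_(size A)) i := `|islack rho a (f i) A`_l|%N.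

Let pointE (l : 'I_(size A)) : A`_l = z + \sum_i (G l i)%:Z *: E i.
Proof.
rewrite -[A`_l in LHS](subrK z) addrC; congr (_ + _).
rewrite [LHS](frame_expandI fr); apply: eq_bigr => i _; congr (_ *: _).
rewrite /G gez0_abs // dotID dotIN; have := frame_slack0 fr i; rewrite /islack; lia.
Qed.

(** The normals at the vertex are dual to the [E i], so their monomials invert the monomial map
    given by [E]. *)
Lemma torus_param (sg : 'I_n -> Cx) : (forall i, sg i != 0) ->
  exists2 t : 'I_n -> Cx, (forall j, t j != 0) & forall i, lmono (E i) t = sg i.
Proof.
move=> sg0; exists (fun q => lmono (\row_j rho (f j) 0 q) sg) => [q|i].
  exact: lmono_neq0.
transitivity (lmono (\row_j (j == i)%:Z) sg).
  rewrite {1}/lmono; under eq_bigr do rewrite -lmonoZ //.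
  rewrite -lmono_sum //; congr (lmono _ sg); apply/rowP => j.
  rewrite summxE mxE -(frame_dual fr); apply: eq_bigr => q _.
  by rewrite !mxE mulrC.
rewrite /lmono (bigD1 i) //= mxE eqxx expr1z big1 ?mulr1 // => j /negbTE ji.
by rewrite mxE ji expr0z.
Qed.

(** With [sg i = lmono (E i) t], every monomial is the nonzero factor [lmono z t] times a local one.
    The exponents in either system are affine in those of the other, and the equation [f = 0]
    absorbs the constants. *)
Lemma dual_coneE : @dual_cone n A = tangent_cone G.
Proof.
have mono t : (forall j, t j != 0) -> forall l : 'I_(size A),
    lmono A`_l t = lmono z t * torus_monomial G (fun i => lmono (E i) t) l.
  move=> t0 l; rewrite [in LHS]pointE lmonoD // lmono_sum //; congr (_ * _).
  by apply: eq_bigr => i _; rewrite lmonoZ.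
have eqns t xi : (forall j, t j != 0) ->
    (\sum_(l < size A) xi l * lmono A`_l t = 0 /\
     forall j, \sum_(l < size A) xi l * ((A`_l) 0 j)%:~R * lmono A`_l t = 0) <->
    (\sum_l xi l * torus_monomial G (fun i => lmono (E i) t) l = 0 /\
     forall i, \sum_l xi l * (G l i)%:R * torus_monomial G (fun i => lmono (E i) t) l = 0).
  move=> t0; set chi := torus_monomial G _; pose c := lmono z t.
  have c0 : c != 0 by apply: lmono_neq0.
  have scal (g : 'I_(size A) -> Cx) : \sum_l xi l * g l * lmono A`_l t =
      c * \sum_l xi l * g l * chi l.
    by rewrite mulr_sumr; apply: eq_bigr => l _; rewrite mono // [RHS]mulrCA.
  have scal1 : \sum_(l < size A) xi l * lmono A`_l t = c * \sum_l xi l * chi l.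
    by rewrite mulr_sumr; apply: eq_bigr => l _; rewrite mono // [RHS]mulrCA.
  have scal0 u : c * u = 0 -> u = 0 by move/eqP; rewrite mulf_eq0 (negbTE c0) => /eqP.
  split=> -[H0 H].
    have {}H0 : \sum_l xi l * chi l = 0 by apply: scal0; rewrite -scal1.
    split=> // i.
    have Gz l : (G l i)%:R = \sum_q (rho (f i) 0 q)%:~R * ((A`_l) 0 q)%:~R + (a (f i))%:~R :> Cx.
      rewrite -[LHS](rmorph_nat (intr : int -> Cx)) natz /G gez0_abs // /islack rmorphD /=.
      by rewrite rmorph_sum; congr (_ + _); apply: eq_bigr => q _; rewrite rmorphM.
    rewrite (eq_bigr (fun l => \sum_q (rho (f i) 0 q)%:~R * (xi l * ((A`_l) 0 q)%:~R * chi l)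
       + (a (f i))%:~R * (xi l * chi l))) => [|l _].
      rewrite big_split /= -mulr_sumr H0 mulr0 addr0 exchange_big big1 //= => q _.
      by rewrite -mulr_sumr [X in _ * X]scal0 ?mulr0 // -scal.
    rewrite Gz mulrDr mulrDl mulr_sumr mulr_suml; congr (_ + _).
      by apply: eq_bigr => q _; rewrite -!mulrA mulrCA.
    by rewrite -mulrA mulrCA.
  split=> [|j]; first by rewrite scal1 H0 mulr0.
  rewrite scal (eq_bigr (fun l => (z 0 j)%:~R * (xi l * chi l) +
      \sum_i (E i 0 j)%:~R * (xi l * (G l i)%:R * chi l))) => [|l _].
    rewrite big_split /= -mulr_sumr H0 mulr0 add0r exchange_big big1 ?mulr0 //= => i _.
    by rewrite -mulr_sumr H mulr0.
  rewrite [in LHS]pointE mxE summxE intrD rmorph_sum mulrDr mulrDl mulr_sumr mulr_suml.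
  congr (_ + _); first by rewrite -mulrA mulrCA.
  apply: eq_bigr => i _; rewrite mxE rmorphM /= -[(_%:Z)%:~R]/((G l i)%:R); ring.
apply/seteqP; split=> xi.
  move=> [t [t0 H0 H]]; have [H0' H'] := (eqns t xi t0).1 (conj H0 H).
  by exists (fun i => lmono (E i) t); split=> // i; apply: lmono_neq0.
move=> [sg [sg0 H0 H]]; have [t t0 tE] := torus_param sg0.
have sgE : (fun i => lmono (E i) t) = sg by apply/funext.
have := (eqns t xi t0).2; rewrite sgE => /(_ (conj H0 H)) [H0' H'].
by exists t; split.
Qed.

Hypothesis uniqA : uniq A.
Hypothesis memA : forall x, x \in A <-> forall i, 0 <= islack rho a i x.
Variables (h : 'I_r) (B : {set 'I_n}).
Hypothesis h1 : islack rho a h z = 1.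
Hypothesis hB : forall j, dotI (rho h) (E j) = - (j \in B)%:Z.
Hypothesis edge : forall i j, 0 <= islack rho a i z + dotI (rho i) (E j).
Hypothesis square : forall s t i, s \in B -> t \notin B ->
  0 <= islack rho a i z + dotI (rho i) (E s) + dotI (rho i) (E t).
Hypothesis small : (#|~: B| <= #|B|)%N.

Lemma dual_cone_zdim : exists dc, zdim (@dual_cone n A) dc /\
  (dc + #|B|.+1 = size A + #|~: B|)%N.
Proof.
have zA : z \in A by apply/memA => i; exact: frame_ge0 fr i.
have iA x : x \in A -> (index x A < size A)%N by rewrite index_mem.
pose idx x : 'I_(size A) := insubd (Ordinal (iA z zA)) (index x A).
have idxE x : x \in A -> A`_(idx x) = x.
  by move=> xA; rewrite insubdK ?nth_index // -topredE /= iA.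
have Gadd x i : z + x \in A -> (G (idx (z + x)) i)%:Z = dotI (rho (f i)) x.
  move=> xA; rewrite /G idxE // gez0_abs; last by have /memA := xA.
  by rewrite islackD (frame_slack0 fr) add0r.
have EA j : z + E j \in A by apply/memA => i; rewrite islackD.
have stA s t : s \in B -> t \notin B -> z + (E s + E t) \in A.
  by move=> sB tB; apply/memA => i; rewrite islackD dotID addrA square.
rewrite dual_coneE.
apply: (@tangent_cone_zdim _ _ B G (idx z) (fun s => idx (z + E s))
  (fun t => idx (z + E t)) (fun s t => idx (z + (E s + E t)))) => //.
(* The exponents in [B] sum to 1 minus the nonnegative slack of [h]. *)
- move=> l.
  have := simplex_slack_sum (intRV A`_l) fr h1 hB.
  rewrite (eq_bigr (fun s => (islack rho a (f s) A`_l)%:~R)) => [|s _]; last exact: slack_int.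
  rewrite slack_int -rmorph_sum -intrD => /(@intr_inj Rl _ 1).
  have := A_ge0 l h; have -> : \sum_(s in B) islack rho a (f s) A`_l =
      (\sum_(s in B) G l s)%N%:Z.
    rewrite -[RHS]natz natr_sum; apply: eq_bigr => s _.
    by rewrite natz /G gez0_abs.
  lia.
- move=> l l' GG; apply: val_inj; apply/eqP.
  rewrite -(nth_uniq 0 (ltn_ord l) (ltn_ord l') uniqA) !pointE; apply/eqP.
  by congr (_ + _); apply: eq_bigr => i _; rewrite GG.
- by move=> i; rewrite /G idxE // (frame_slack0 fr).
- move=> s i _; apply/eqP; rewrite -eqz_nat Gadd // (frame_dual fr) //.
- move=> t i _; apply/eqP; rewrite -eqz_nat Gadd // (frame_dual fr) //.
- move=> s t i sB tB; apply/eqP; rewrite -eqz_nat Gadd ?stA // dotID !(frame_dual fr).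
  have st : (s == t) = false by apply: contraNF tB => /eqP <-.
  by have [->|_] := eqVneq i s; rewrite ?st ?add0r.
Qed.
End ToricDual.

(** * Each of the three conditions as the bound [n + 3 <= 2 * c] *)

Theorem theorem1p12 (n r : nat) (rho : 'I_r -> 'rV[int]_n) (a : 'I_r -> int)
  (A : seq 'rV[int]_n) (c : nat) :
  lattice_polytope_data rho a ->
  smooth_polytope rho a ->
  uniq A ->
  (forall z, z \in A <-> Hset rho a (intRV z)) ->
  codeg_spec rho a c ->
  ((Qnormal rho a /\ (n%:R + 3) / 2 <= (c%:R : Rl)) <->
   (exists k : nat, [/\ k.+1 = c, n%:R / 2 < (k%:R : Rl)
                      & strict_cayley (Hset rho a) k])) /\
  ((exists k : nat, [/\ k.+1 = c, n%:R / 2 < (k%:R : Rl)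
                      & strict_cayley (Hset rho a) k]) <->
   defective_with_defect A (2 * c%:Z - 2 - n%:Z)).
Proof.
move=> [bounded [x0 x0int] _ _ lattice] smooth uniqA AP codeg.
have nonempty : exists x, Hset rho a x by exists x0 => i; apply: ltW.
have halfP k : k.+1 = c -> (n%:R / 2 < (k%:R : Rl)) = (n + 3 <= 2 * c)%N.
  move=> <-; rewrite ltr_pdivrMr // -natrM ltr_nat; lia.
have cayley_big : (n + 3 <= 2 * c)%N -> exists k : nat, [/\ k.+1 = c,
    n%:R / 2 < (k%:R : Rl) & strict_cayley (Hset rho a) k].
  move=> big; have [k [kc cay]] := polytope_cayley bounded lattice smooth nonempty codeg big AP.
  by exists k; split; rewrite ?halfP.
have big_cayley : (exists k : nat, [/\ k.+1 = c,
    n%:R / 2 < (k%:R : Rl) & strict_cayley (Hset rho a) k]) -> (n + 3 <= 2 * c)%N.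
  by move=> [k [kc + _]]; rewrite halfP.
split; split.
- move=> [_ big]; apply: cayley_big.
  by move: big; rewrite ler_pdivrMr // -!natrD -natrM ler_nat mulnC.
- move=> /big_cayley big; split; first exact: (polytope_Qnormal bounded lattice smooth nonempty codeg).
  by rewrite ler_pdivrMr // -!natrD -natrM ler_nat mulnC.
- move=> /big_cayley big.
  have [z [f [E fr]]] := frame_exists bounded lattice smooth nonempty.
  have [h [B [h1 hB cE square _]]] := frame_structure bounded lattice smooth codeg big fr.
  have cB : (#|B| + #|~: B| = n)%N by rewrite cardsC card_ord.
  have memA x : x \in A <-> forall i, 0 <= islack rho a i x.
    split=> [/AP /PE H i|H]; first by rewrite -(ler0z Rl) -slack_int.
    by apply/AP/PE => i; rewrite slack_int ler0z.
  have A_ge0 (l : 'I_(size A)) i : 0 <= islack rho a i A`_l.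
    by apply: (memA _).1; rewrite mem_nth.
  (* With [#|B| = c - 1], the dimension count gives the defect [#|B| - #|~: B| = 2 * c - 2 - n],
     positive by the bound. *)
  have [|dc [dim dcE]] := dual_cone_zdim fr A_ge0 uniqA memA h1 hB
    (frame_edge_ge0 bounded lattice smooth fr) square; first by lia.
  by exists dc; split=> //; lia.
- by move=> [dc [_ [_ pos]]]; apply: cayley_big; lia.
Qed.
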